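(* There exist non-degenerate distributions $F_-$ and $F_+$ on $[0,\infty)$ (which may be taken with bounded support, so that $\mathbb{E}Y_\pm<\infty$) such that $$\bar\mu(\mathbf e_2)<\min\{\mu_-(\mathbf e_2),\mu_+(\mathbf e_2)\}.$$
   Context: Inhomogeneous first-passage percolation on $\mathbb{Z}^2$. Given distribution functions $F_-,F_+$ of probability measures on $[0,\infty)$, edge weights $(\tau_e)$ on nearest-neighbour edges of $\mathbb{Z}^2$ are independent; $\tau_e\sim F_-$ if at least one endpoint of $e$ has strictly negative first coordinate, and $\tau_e\sim F_+$ otherwise. $T(u,v)$ is the infimum over nearest-neighbour paths from $u$ to $v$ of the sum of edge weights. $Y_\pm$ is the minimum of four i.i.d. $F_\pm$ variables. $\bar\mu(\mathbf e_2)=\lim_n T(0,n\mathbf e_2)/n$ (almost surely). $\mu_\pm(x)$ is the time constant of homogeneous first-passage percolation with i.i.d. $F_\pm$ weights, i.e. the limit in probability of $T_{F_\pm}(0,nx)/n$. A distribution is non-degenerate if it is not a point mass. *)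

(* Defs.v *)
From HB Require Import structures.
From mathcomp Require Import all_boot all_order all_algebra.
From mathcomp Require Import all_classical all_reals all_analysis.
Set Implicit Arguments. Unset Strict Implicit. Unset Printing Implicit Defensive.
Import Order.TTheory GRing.Theory Num.Theory.
Import numFieldNormedType.Exports.
Local Open Scope classical_set_scope.
Local Open Scope ring_scope.

Definition vertex := (int * int)%type.
(* Nearest-neighbour edges: (x, true) joins x and x + e1,
   (x, false) joins x and x + e2.  Every edge is represented exactly once. *)
Definition edge := (vertex * bool)%type.

Definition e1 : vertex := (1%:Z, 0%:Z).
Definition e2 : vertex := (0%:Z, 1%:Z).
Definition vadd (u v : vertex) : vertex := (u.1 + v.1, u.2 + v.2).

Definition edge_src (e : edge) : vertex := e.1.
Definition edge_tgt (e : edge) : vertex := vadd e.1 (if e.2 then e1 else e2).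

Definition adj (u v : vertex) : bool := `|u.1 - v.1| + `|u.2 - v.2| == 1.

Definition edge_of (u v : vertex) : edge :=
  if v == vadd u e1 then (u, true)
  else if u == vadd v e1 then (v, true)
  else if v == vadd u e2 then (u, false)
  else (v, false).

Definition edge_neg (e : edge) : bool :=
  ((edge_src e).1 < 0) || ((edge_tgt e).1 < 0).

Definition path_time {R : realType} {Omega : Type} (tau : edge -> Omega -> R)
  (u : vertex) (p : seq vertex) (w : Omega) : R :=
  \sum_(e <- pairmap edge_of u p) tau e w.

Definition passage_time {R : realType} {Omega : Type} (tau : edge -> Omega -> R)
  (u v : vertex) (w : Omega) : R :=
  inf [set t : R | exists p : seq vertex,
         [/\ path adj u p, last u p = v & t = path_time tau u p w]].

Definition indep_edge_weights {R : realType} {d : measure_display}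
  {Omega : measurableType d} (P : probability Omega R)
  (tau : edge -> Omega -> R) (L : edge -> probability R R) : Prop :=
  [/\ (forall e, measurable_fun setT (tau e)),
      (forall e (B : set R), measurable B -> P (tau e @^-1` B) = L e B) &
      (forall (s : seq edge) (B : edge -> set R), uniq s ->
          (forall e, measurable (B e)) ->
          P (\big[setI/setT]_(e <- s) (tau e @^-1` B e)) =
          (\prod_(e <- s) P (tau e @^-1` B e))%E)].

Definition bounded_nonneg_law {R : realType} (F : probability R R) : Prop :=
  exists M : R, F [set x : R | 0 <= x <= M] = 1%E.

Definition not_point_mass {R : realType} (F : probability R R) : Prop :=
  forall x : R, ~ (forall A : set R, measurable A -> F A = \d_x A).

Definition ne2 (n : nat) : vertex := (0%:Z, n%:Z).

(* Main.v *)
(** Give the edges integer weights driven by i.i.d. bits, true with probability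
    255/256: the left half-plane takes the values A and A + 1, the right one the
    values 1 and 2A, with A very large.
    Existence of the limits.  Averaging over finitely many bits gives an
    expectation that satisfies the Efron-Stein inequality.  Raising one weight
    changes the passage time only if its edge lies on a geodesic, so the variance
    of T(0, n e2) is O(n); the means are subadditive, hence m_n / n converges
    (Fekete).  Chebyshev yields the limit in probability; Borel-Cantelli along
    n = k^4, with deviations k^3, together with the Lipschitz bound between
    consecutive fourth powers, yields the almost sure limit.
    Strictness.  On the left all weights are at least A, so mu_- >= A.  On the
    right, at most 4^n simple paths of length n leave the origin and each is
    cheaper than A n with probability at most 8^-n, so mu_+ >= A.  Near the
    interface, climb the column -1 at cost at most A + 1 per edge and detour
    through the column 0 whenever three consecutive edges there have weight 1;
    the gain, at least 256^-3 (A - 2) per block of three on average, exceeds the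
    loss 3. *)

Require Import Defs.
From HB Require Import structures.
From mathcomp Require Import all_boot all_order all_algebra.
From mathcomp Require Import all_classical all_reals all_analysis.
From mathcomp Require Import measurable_realfun zify ring lra.
Import Order.TTheory GRing.Theory Num.Theory.
Import numFieldNormedType.Exports.
Local Open Scope classical_set_scope.
Local Open Scope ring_scope.

Set Implicit Arguments.
Unset Strict Implicit.
Unset Printing Implicit Defensive.

(** * Expectation over finitely many Bernoulli bits *)

Section bernoulli_expectation.
Variables (R : realType) (I : choiceType) (q : R).
Hypothesis q01 : 0 <= q <= 1.

Definition upd (c : I -> bool) (e : I) (b : bool) : I -> bool :=
  fun x => if x == e then b else c x.

(** The conditional expectation given all bits except [e], kept as a function of the whole
    configuration so that such averages compose and commute. *)
Definition resample (e : I) (f : (I -> bool) -> R) : (I -> bool) -> R :=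
  fun c => q * f (upd c e true) + (1 - q) * f (upd c e false).

(* [expect s f c] averages [f] over independent Bernoulli(q) bits on the
   coordinates in [s], the others being frozen to their values in [c]. *)
Definition expect (s : seq I) (f : (I -> bool) -> R) : (I -> bool) -> R :=
  foldr resample f s.

Definition depends_on (s : seq I) T (f : (I -> bool) -> T) : Prop :=
  forall c c', {in s, c =1 c'} -> f c = f c'.

Lemma depends_on_sub (s s' : seq I) T (f : (I -> bool) -> T) :
  {subset s <= s'} -> depends_on s f -> depends_on s' f.
Proof. by move=> ss' fs c c' cc'; apply: fs => e /ss'; exact: cc'. Qed.

Lemma upd_same c e b : upd c e b e = b.
Proof. by rewrite /upd eqxx. Qed.

Lemma upd_upd c e b b' : upd (upd c e b) e b' = upd c e b'.
Proof. by apply/funext => x; rewrite /upd; case: eqP. Qed.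

Lemma upd_comm c e e' b b' : e != e' ->
  upd (upd c e b) e' b' = upd (upd c e' b') e b.
Proof.
move=> ee'; apply/funext => x; rewrite /upd.
by case: eqP => // ->; rewrite eq_sym (negbTE ee').
Qed.

Lemma resample_comm e e' f : resample e (resample e' f) = resample e' (resample e f).
Proof.
have [-> //|ee'] := eqVneq e e'.
apply/funext => c; rewrite /resample !(upd_comm _ _ _ ee'); ring.
Qed.

Lemma resampleK e f : resample e (resample e f) = resample e f.
Proof. by apply/funext => c; rewrite /resample !upd_upd; ring. Qed.

Lemma ler_resample e f g c : (forall c, f c <= g c) ->
  resample e f c <= resample e g c.
Proof. by case/andP: q01 => ? ? fg; rewrite lerD// ler_wpM2l// subr_ge0. Qed.

Lemma ler_expect s f g c : (forall c, f c <= g c) -> expect s f c <= expect s g c.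
Proof.
by move=> fg; elim: s c => [//|e s IH] c /=; apply: ler_resample.
Qed.

Lemma expect_cst s k : expect s (fun=> k) = fun=> k.
Proof.
elim: s => [//|e s IH] /=; rewrite IH.
by apply/funext => c; rewrite /resample; ring.
Qed.

Lemma expectD s f g : expect s (fun c => f c + g c) = fun c => expect s f c + expect s g c.
Proof.
elim: s => [//|e s IH] /=; rewrite IH.
by apply/funext => c; rewrite /resample /expect; ring.
Qed.

Lemma expectZ s k f : expect s (fun c => k * f c) = fun c => k * expect s f c.
Proof.
elim: s => [//|e s IH] /=; rewrite IH.
by apply/funext => c; rewrite /resample /expect; ring.
Qed.

Lemma expect_sum s (J : Type) (r : seq J) (F : J -> (I -> bool) -> R) :
  expect s (fun c => \sum_(j <- r) F j c) = fun c => \sum_(j <- r) expect s (F j) c.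
Proof.
elim: r => [|j r IH].
  under eq_fun do rewrite big_nil.
  by rewrite expect_cst; apply/funext => c; rewrite big_nil.
under eq_fun do rewrite big_cons.
by rewrite expectD IH; apply/funext => c; rewrite big_cons.
Qed.

Lemma expect_ge0 s f c : (forall c, 0 <= f c) -> 0 <= expect s f c.
Proof. by move=> f0; rewrite -[leLHS](congr1 (@^~ c) (expect_cst s 0)); exact: ler_expect. Qed.

Lemma resample_expect e s f : resample e (expect s f) = expect s (resample e f).
Proof.
elim: s => [//|e' s IH] /=.
by rewrite resample_comm [resample e _]IH.
Qed.

Lemma expect_resample e s f : e \in s -> expect s (resample e f) = expect s f.
Proof.
elim: s => [//|e' s IH]; rewrite inE => /predU1P[<-|/IH {}IH] /=.
  by rewrite -resample_expect resampleK.
by rewrite IH.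
Qed.

Lemma expect_comm s s' f : expect s (expect s' f) = expect s' (expect s f).
Proof.
by elim: s => [//|e s IH]; rewrite /= IH [RHS]/= resample_expect.
Qed.

Lemma expect_agree s s0 f c c' : depends_on s0 f ->
  (forall e, e \in s0 -> e \notin s -> c e = c' e) -> expect s f c = expect s f c'.
Proof.
move=> fs0; elim: s c c' => [|e s IH] c c' cc' /=.
  by apply: fs0 => e es0; exact: cc'.
rewrite /resample; congr (_ * _ + _ * _); apply: IH => x xs0 xs; rewrite /upd;
  by case: eqVneq => // xe; apply: cc'; rewrite // inE negb_or xe.
Qed.

Lemma expect_depends s f c c' : depends_on s f -> expect s f c = expect s f c'.
Proof. by move=> fs; apply: (expect_agree fs) => e ->. Qed.

(** Average over both supports in either order: the inner average is already constant, so the outer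
    one does nothing. *)
Lemma expect_indep s s' f c c' : depends_on s f -> depends_on s' f ->
  expect s f c = expect s' f c'.
Proof.
move=> fs fs'; have -> : expect s f c = expect s' (expect s f) c.
  have -> : expect s f = fun=> expect s f c by apply/funext=> x; exact: expect_depends.
  by rewrite expect_cst.
rewrite expect_comm.
have -> : expect s' f = fun=> expect s' f c' by apply/funext=> x; exact: expect_depends.
by rewrite expect_cst.
Qed.

Definition variance_on s f : (I -> bool) -> R :=
  fun c => expect s (fun c => f c ^+ 2) c - expect s f c ^+ 2.

Lemma variance_onE s f c :
  variance_on s f c = expect s (fun c' => (f c' - expect s f c) ^+ 2) c.
Proof.
rewrite /variance_on; set m := expect s f c.
have -> : (fun c' => (f c' - m) ^+ 2) =
    (fun c' => f c' ^+ 2 + ((- 2 * m) * f c' + m ^+ 2)).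
  by apply/funext => x; ring.
by rewrite !expectD expectZ expect_cst -/m; ring.
Qed.

Lemma variance_on_ge0 s f c : 0 <= variance_on s f c.
Proof. by rewrite variance_onE; apply: expect_ge0 => ?; rewrite sqr_ge0. Qed.

Lemma chebyshev_expect s f (m x : R) c : 0 < x -> expect s f c = m ->
  expect s (fun c => ((x <= `|f c - m|)%R)%:R) c <= variance_on s f c / x ^+ 2.
Proof.
move=> x0 <-; rewrite variance_onE; set m' := expect s f c.
rewrite ler_pdivlMr ?exprn_gt0// mulrC -[leLHS](congr1 (@^~ c) (expectZ _ _ _)).
apply: ler_expect => // y; case: (boolP (x <= _)) => [xy|_].
  by rewrite mulr1 -(real_normK (num_real (f y - m'))) ler_sqr ?nnegrE// ltW.
by rewrite mulr0 sqr_ge0.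
Qed.

Definition discrete_diff e f : (I -> bool) -> R :=
  fun c => f (upd c e true) - f (upd c e false).

Lemma expect_discrete_diff e s f : e \notin s ->
  discrete_diff e (expect s f) = expect s (discrete_diff e f).
Proof.
elim: s => [//|e' s IH]; rewrite inE negb_or => /andP[ee' /IH {}IH] /=.
rewrite -IH.
apply/funext => c; rewrite /discrete_diff /resample -!(upd_comm _ _ _ ee').
by rewrite /expect; ring.
Qed.

(* Each step of the recursion is the law of total variance; Jensen's inequality
   moves the square inside the average over the remaining coordinates. *)
Lemma efron_stein s f c : uniq s ->
  variance_on s f c <=
  \sum_(e <- s) q * (1 - q) * expect s (fun c => discrete_diff e f c ^+ 2) c.
Proof.
case/andP: (q01) => q0 q1; have q1' : 0 <= 1 - q by rewrite subr_ge0.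
elim: s c => [|e s IH] c.
  by rewrite /variance_on big_nil /= subrr.
case/andP=> es us; rewrite big_cons.
(* A two-valued variable with gap [D] has variance [q * (1 - q) * D ^+ 2]. *)
have -> : variance_on (e :: s) f c =
    resample e (variance_on s f) c + q * (1 - q) * discrete_diff e (expect s f) c ^+ 2.
  by rewrite /variance_on /= /resample /discrete_diff /expect; ring.
rewrite addrC; apply: lerD.
- rewrite ler_wpM2l ?mulr_ge0// expect_discrete_diff//.
  have -> : expect (e :: s) (fun c0 => discrete_diff e f c0 ^+ 2) =
      expect s (fun c0 => discrete_diff e f c0 ^+ 2).
    rewrite [LHS]/= [LHS]resample_expect; congr expect; apply/funext => x.
    by rewrite /resample /discrete_diff !upd_upd; ring.
  (* Jensen's inequality for the square is the nonnegativity of the variance of the discrete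
     difference. *)
  by rewrite -subr_ge0; exact: variance_on_ge0.
- apply: (@le_trans _ _ (resample e (fun c => \sum_(e' <- s) q * (1 - q) *
    expect s (fun c => discrete_diff e' f c ^+ 2) c) c)).
    by apply: ler_resample => x; exact: IH.
  rewrite /resample !big_distrr /= -big_split /=; apply: ler_sum => e' _.
  by rewrite /resample /expect; lra.
Qed.

(** Independence: the factor at [e] is constant for the average over the other coordinates, provided
    that [e] does not recur among them. *)
Lemma expect_prod s (g : bool -> R) : uniq s ->
  expect s (fun c => \prod_(e <- s) g (c e)) =
  fun=> (q * g true + (1 - q) * g false) ^+ size s.
Proof.
have pull e t f : e \notin t ->
    expect t (fun c => g (c e) * f c) = fun c => g (c e) * expect t f c.
  elim: t => [//|e' t IH]; rewrite inE negb_or => /andP[ee' /IH {}IH] /=.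
  rewrite IH; apply/funext => c; rewrite /resample /upd (negbTE ee').
  by rewrite /expect; ring.
elim: s => [|e s IH]; first by move=> _; apply/funext=> c; rewrite /= big_nil.
case/andP=> es us /=; under eq_fun do rewrite big_cons.
rewrite pull// IH//; apply/funext=> c.
by rewrite /resample !upd_same exprS; ring.
Qed.

(* Independent of the chosen support, by [cyl_expectE]; junk when [f] depends on
   infinitely many bits. *)
Definition cyl_expect (f : (I -> bool) -> R) : R :=
  expect (xget [::] [set s | depends_on s f]) f (fun=> false).

Lemma cyl_expectE s f c : depends_on s f -> cyl_expect f = expect s f c.
Proof.
move=> fs; rewrite /cyl_expect; case: xgetP => [s' _ fs'|/(_ s)//].
exact: expect_indep.
Qed.

End bernoulli_expectation.

(** The source of translation invariance for means: a shift of the lattice renames the bits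
    injectively. *)
Lemma expect_reindex (R : realType) (I : choiceType) (q : R) (h : I -> I) s
    (f : (I -> bool) -> R) c : injective h ->
  expect q (map h s) (fun c => f (c \o h)) c = expect q s f (c \o h).
Proof.
move=> hI; elim: s c => [//|e s IH] c /=.
have updh b : upd c (h e) b \o h = upd (c \o h) e b.
  by apply/funext => x; rewrite /upd /= (inj_eq hI).
by rewrite /resample -!updh -!IH.
Qed.

(** * Lattice paths and passage times *)
Definition nbrs (v : vertex) : seq vertex :=
  [:: vadd v e1; vadd v (-1, 0); vadd v e2; vadd v (0, -1)].

Lemma adjE u v : adj u v = (v \in nbrs u).
Proof.
case: u v => [a b] [a' b']; rewrite /adj /nbrs /vadd !inE -!pair_eqE /=.
by apply/idP/idP; lia.
Qed.

(** The last branch of [edge_of] is a default; adjacency is what forces [v] to lie just below [u]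
    there. *)
Lemma edge_of_ends u v : adj u v ->
  (edge_src (edge_of u v), edge_tgt (edge_of u v)) = (u, v) \/
  (edge_src (edge_of u v), edge_tgt (edge_of u v)) = (v, u).
Proof.
rewrite /edge_of adjE.
case: eqP => [-> _|n1]; first by left.
case: eqP => [-> _|n2]; first by right.
case: eqP => [-> _|n3]; first by left.
have vaddNK (w z : vertex) : w = vadd (vadd w (- z.1, - z.2)) z.
  by case: w z => [a b] [x y]; rewrite /vadd /= !subrK.
rewrite !inE => /or4P[] /eqP vE.
- by case: n1.
- by case: n2; rewrite vE; exact: (vaddNK u e1).
- by case: n3.
- by right; rewrite /edge_src /edge_tgt /= vE; congr pair; rewrite -(vaddNK u e2).
Qed.

Lemma last_adj_dist u p : path adj u p ->
  (`|((last u p).2 - u.2)%R| <= size p)%N.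
Proof.
elim: p u => [|v p IH] u /=; first by rewrite subrr.
case/andP; rewrite /adj => /eqP uv /IH; lia.
Qed.

Definition vshift (m : int) (v : vertex) : vertex := (v.1, v.2 + m).
Definition eshift (m : int) (e : edge) : edge := (vshift m e.1, e.2).

Lemma vshift_inj m : injective (vshift m).
Proof. by move=> [a b] [c d] [] -> /addIr ->. Qed.

Lemma eshift_inj m : injective (eshift m).
Proof. by move=> [[a b] x] [[a' b'] x'] [-> /addIr -> ->]. Qed.

Lemma adj_vshift m u v : adj (vshift m u) (vshift m v) = adj u v.
Proof. by rewrite /adj /=; congr (_ + `|_| == _); ring. Qed.

Lemma edge_of_vshift m u v : edge_of (vshift m u) (vshift m v) = eshift m (edge_of u v).
Proof.
have sh w z : vadd (vshift m w) z = vshift m (vadd w z).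
  by rewrite /vadd /vshift /=; congr pair; ring.
by rewrite /edge_of !sh !(inj_eq (@vshift_inj m)); do ![case: ifP => _].
Qed.

Lemma edge_neg_eshift m e : edge_neg (eshift m e) = edge_neg e.
Proof. by case: e => [[a b] []]. Qed.

Lemma path_vshift m u p : path adj (vshift m u) (map (vshift m) p) = path adj u p.
Proof. by elim: p u => [//|v p IH] u /=; rewrite adj_vshift IH. Qed.

Definition path_edges (u : vertex) (p : seq vertex) : seq edge := pairmap edge_of u p.

Lemma path_edges_cat u p p' :
  path_edges u (p ++ p') = path_edges u p ++ path_edges (last u p) p'.
Proof. exact: pairmap_cat. Qed.

Lemma path_edges_vshift m u p :
  path_edges (vshift m u) (map (vshift m) p) = map (eshift m) (path_edges u p).
Proof. by elim: p u => [//|v p IH] u /=; rewrite edge_of_vshift IH. Qed.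

Lemma mem_path_edges u p e : path adj u p -> e \in path_edges u p ->
  (edge_src e \in u :: p) && (edge_tgt e \in u :: p).
Proof.
elim: p u => [//|v p IH] u /= /andP[uv vp]; rewrite in_cons => /predU1P[->|/(IH _ vp)].
  by case: (edge_of_ends uv) => -[-> ->]; rewrite !inE !eqxx ?orbT.
by rewrite !(in_cons u) => /andP[-> ->]; rewrite !orbT.
Qed.

(** The first edge has [u] as an endpoint, and later edges only join vertices of the tail, where [u]
    never returns. *)
Lemma uniq_path_edges u p : path adj u p -> uniq (u :: p) -> uniq (path_edges u p).
Proof.
elim: p u => [//|v p IH] u /= /andP[uv vp] /andP[uvp uniq_vp].
rewrite IH// andbT; apply/negP => /(mem_path_edges vp).
by case: (edge_of_ends uv) => -[-> ->]; rewrite (negbTE uvp) ?andbF.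
Qed.

(** This enumeration serves twice: it yields finite supports for passage times, and its size [4 ^ n]
    enters the union bound on cheap paths. *)
Fixpoint paths_from (u : vertex) (n : nat) : seq (seq vertex) :=
  if n is n'.+1 then [seq v :: p | v <- nbrs u, p <- paths_from v n'] else [:: [::]].

Lemma paths_fromS u n :
  paths_from u n.+1 = [seq v :: p | v <- nbrs u, p <- paths_from v n].
Proof. by []. Qed.

Lemma size_paths_from u n : size (paths_from u n) = (4 ^ n)%N.
Proof.
elim: n u => [//|n IH] u; rewrite [paths_from _ _]/= !size_cat /= !size_map !IH expnS; lia.
Qed.

Lemma mem_paths_from u p : path adj u p -> p \in paths_from u (size p).
Proof.
elim: p u => [//|v p IH] u /andP[]; rewrite adjE => uv /IH vp.
by rewrite [size _]/= paths_fromS; apply/allpairsPdep; exists v, p.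
Qed.

Lemma size_mem_paths_from u n p : p \in paths_from u n -> size p = n /\ path adj u p.
Proof.
elim: n u p => [|n IH] u p; first by rewrite inE => /eqP ->.
rewrite paths_fromS => /allpairsPdep[v [p' [uv /IH[sp vp] ->]]] /=.
by rewrite sp adjE uv.
Qed.

(** A finite set of bits sufficient for any quantity decided by walks of at most [r] steps.
    Duplicates are removed because the Efron-Stein inequality needs distinct coordinates. *)
Definition edge_ball (u : vertex) (r : nat) : seq edge :=
  undup (flatten [seq path_edges u p | n <- iota 0 r.+1, p <- paths_from u n]).

Lemma mem_edge_ball u r p : path adj u p -> (size p <= r)%N ->
  {subset path_edges u p <= edge_ball u r}.
Proof.
move=> up pr e ep; rewrite mem_undup; apply/flattenP; exists (path_edges u p) => //.
by apply/allpairsPdep; exists (size p), p; rewrite mem_iota mem_paths_from.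
Qed.

(** * Geodesics for positive bounded integer weights *)

Section first_passage.
Variables (wt : edge -> bool -> nat) (b : nat).
Hypothesis wt_gt0 : forall e x, (0 < wt e x)%N.
Hypothesis wt_le : forall e x, (wt e x <= b)%N.

Definition ptime (c : edge -> bool) (u : vertex) (p : seq vertex) : nat :=
  (\sum_(e <- path_edges u p) wt e (c e))%N.

Lemma ptime_cat c u p p' : ptime c u (p ++ p') = (ptime c u p + ptime c (last u p) p')%N.
Proof. by rewrite /ptime path_edges_cat big_cat. Qed.

Lemma size_le_ptime c u p : (size p <= ptime c u p)%N.
Proof.
rewrite -(size_pairmap edge_of u) /ptime -sum1_size.
by apply: leq_sum => e _; exact: wt_gt0.
Qed.

Lemma ptime_le_size c u p : (ptime c u p <= b * size p)%N.
Proof.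
rewrite -(size_pairmap edge_of u) /ptime -sum1_size big_distrr /=.
by apply: leq_sum => e _; rewrite muln1.
Qed.

(** Loop erasure from the end of the path: the tail is already simple, and if it revisits [u], only
    the part after that visit is kept. Dropping edges cannot raise the cost. *)
Lemma simple_path c u p : path adj u p -> exists p',
  [/\ path adj u p', last u p' = last u p, uniq (u :: p') & (ptime c u p' <= ptime c u p)%N].
Proof.
elim: p u => [|v p IH] u /=; first by exists [::].
case/andP => uv /IH[p' [vp' lp' up' tp']].
have le : (ptime c u (v :: p') <= ptime c u (v :: p))%N.
  by rewrite /ptime /= !big_cons leq_add2l.
have [uin|unin] := boolP (u \in v :: p'); last first.
  by exists (v :: p'); split; [rewrite /= uv | | rewrite cons_uniq unin | ].
move: uin vp' lp' up' le; rewrite inE => /predU1P[<- vp' lp' up' le|].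
  exists p'; split=> //; apply: leq_trans le.
  by rewrite /ptime /= big_cons leq_addl.
case/splitPr => p1 p2; rewrite cat_path last_cat /= => /and3P[_ _ vp2] lp2 up2 le.
exists p2; split=> //; first by move: up2; rewrite cat_uniq => /and4P[].
apply: leq_trans le; rewrite -cat_cons -cat_rcons ptime_cat last_rcons.
exact: leq_addl.
Qed.

(** The length [k] is recorded because [b * k] then bounds the passage time, hence also the length
    of every geodesic. *)
Definition reach u v (k : nat) := exists p, [/\ path adj u p, last u p = v & size p = k].

Definition is_geodesic c u v p :=
  [/\ path adj u p, last u p = v, uniq (u :: p) &
   forall p', path adj u p' -> last u p' = v -> (ptime c u p <= ptime c u p')%N].

(** Path costs are natural numbers, so a least one exists; loop erasure makes its path simple. *)
Lemma ex_geodesic c u v k : reach u v k -> exists p, is_geodesic c u v p.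
Proof.
move=> [p0 [up0 lp0 _]].
have ex : exists m, `[< exists p, [/\ path adj u p, last u p = v & ptime c u p = m] >].
  by exists (ptime c u p0); apply/asboolP; exists p0.
case: (ex_minnP ex) => m /asboolP[p [up lp tp]] mmin.
have [p' [up' lp' unp' tp']] := simple_path c up.
exists p'; split=> //; first by rewrite lp'.
move=> p2 up2 lp2; apply: leq_trans tp' _; rewrite tp; apply: mmin.
by apply/asboolP; exists p2.
Qed.

Definition geodesic c u v : seq vertex := xget [::] [set p | is_geodesic c u v p].

Definition dist u v (c : edge -> bool) : nat := ptime c u (geodesic c u v).

Lemma geodesicP c u v k : reach u v k -> is_geodesic c u v (geodesic c u v).
Proof. by move=> /(ex_geodesic c)[p gp]; apply: (@xgetPex _ [::] [set p | is_geodesic c u v p]); exists p. Qed.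

Lemma dist_le_ptime c u v p : path adj u p -> last u p = v -> (dist u v c <= ptime c u p)%N.
Proof.
move=> up lp; have /(geodesicP c)[_ _ _] : reach u v (size p) by exists p.
exact.
Qed.

Lemma dist_le c u v k : reach u v k -> (dist u v c <= b * k)%N.
Proof.
by move=> [p [up lp <-]]; apply: leq_trans (ptime_le_size c u p); exact: dist_le_ptime.
Qed.

Lemma size_geodesic c u v k : reach u v k -> (size (geodesic c u v) <= b * k)%N.
Proof. by move=> /(dist_le c); apply: leq_trans; exact: size_le_ptime. Qed.

Lemma dist_triangle c u v w k l : reach u v k -> reach v w l ->
  (dist u w c <= dist u v c + dist v w c)%N.
Proof.
move=> /(geodesicP c)[up lp _ _] /(geodesicP c)[vp lp' _ _].
have := @dist_le_ptime c u w (geodesic c u v ++ geodesic c v w).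
by rewrite cat_path up lp vp last_cat lp lp' ptime_cat lp; exact.
Qed.

Lemma reach_trans u v w k l : reach u v k -> reach v w l -> reach u w (k + l).
Proof.
move=> [p [up lp <-]] [p' [vp lp' <-]]; exists (p ++ p').
by rewrite cat_path last_cat size_cat up lp.
Qed.

Lemma reach_adj u v : adj u v -> reach u v 1.
Proof. by move=> uv; exists [:: v]; rewrite /= uv. Qed.

Lemma reach_up u n : reach u (vshift n%:Z u) n.
Proof.
elim: n => [|n IH]; first by exists [::]; split=> //=; case: u => a b'; rewrite /vshift addr0.
rewrite -addn1; apply: reach_trans IH _; apply: reach_adj.
by rewrite /adj /vshift /=; lia.
Qed.

Lemma reach_down u n : reach (vshift n%:Z u) u n.
Proof.
elim: n => [|n IH]; first by exists [::]; split=> //=; case: u => a b'; rewrite /vshift addr0.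
rewrite -add1n; apply: reach_trans IH; apply: reach_adj.
by rewrite /adj /vshift /=; lia.
Qed.

Lemma eq_ptime c c' u p : {in path_edges u p, c =1 c'} -> ptime c u p = ptime c' u p.
Proof. by move=> cc'; apply: eq_big_seq => e /cc' ->. Qed.

(** A geodesic costs at most [b * k] and each edge at least 1, so it has at most [b * k] edges and
    stays in the ball. Two configurations agreeing there can use each other's geodesics. *)
Lemma dist_depends u v k : reach u v k -> depends_on (edge_ball u (b * k)) (dist u v).
Proof.
move=> uv; suff le c c' : {in edge_ball u (b * k), c =1 c'} -> (dist u v c <= dist u v c')%N.
  move=> c c' cc'; apply/eqP; rewrite eqn_leq le// le// => e /cc' //.
move=> cc'; have [up lp _ _] := geodesicP c' uv.
apply: leq_trans (dist_le_ptime c up lp) _; rewrite leq_eqVlt; apply/orP; left; apply/eqP.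
by apply: eq_ptime => e /(mem_edge_ball up (size_geodesic c' uv)) /cc'.
Qed.

Hypothesis wt_mono : forall e, (wt e false <= wt e true)%N.

(** The upper bound tests the geodesic of the low configuration in the raised one. It is simple, so
    it pays for [e] at most once, and not at all if it avoids [e]. *)
Lemma dist_upd u v k c e : reach u v k ->
  (dist u v (upd c e false) <= dist u v (upd c e true) <=
   dist u v (upd c e false) + b * (e \in path_edges u (geodesic (upd c e false) u v)))%N.
Proof.
move=> uv; apply/andP; split.
  have [up lp _ _] := geodesicP (upd c e true) uv.
  apply: leq_trans (dist_le_ptime _ up lp) _; apply: leq_sum => e' _.
  by rewrite /upd; case: eqP => // ->.
have [up lp unp _] := geodesicP (upd c e false) uv.
apply: leq_trans (dist_le_ptime _ up lp) _; rewrite /dist.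
set g := geodesic _ _ _ in up lp unp *.
have ug := uniq_path_edges up unp.
have [eg|eg] := boolP (e \in path_edges u g); last first.
  rewrite muln0 addn0 leq_eqVlt; apply/orP; left; apply/eqP.
  by apply: eq_ptime => e' e'g; rewrite /upd; case: eqP eg => // <-; rewrite e'g.
rewrite /ptime !(bigD1_seq e)//= muln1 addnAC leq_add//.
  by apply: leq_trans (wt_le _ _) _; rewrite leq_addl.
by rewrite leq_eqVlt; apply/orP; left; apply/eqP; apply: eq_bigr => e' /negbTE ee'; rewrite /upd ee'.
Qed.

Hypothesis wt_shift : forall m e x, wt (eshift m e) x = wt e x.

Lemma ptime_vshift m c u p :
  ptime c (vshift m u) (map (vshift m) p) = ptime (c \o eshift m) u p.
Proof.
rewrite /ptime path_edges_vshift big_map; apply: eq_bigr => e _; exact: wt_shift.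
Qed.

Lemma dist_vshift m u v k c : reach u v k ->
  dist (vshift m u) (vshift m v) c = dist u v (c \o eshift m).
Proof.
(* Shifting a geodesic gives one inequality; the other is the same statement for the inverse
   shift. *)
suff le m' u' v' c' : reach u' v' k ->
    (dist (vshift m' u') (vshift m' v') c' <= dist u' v' (c' \o eshift m'))%N.
  move=> uv; apply/eqP; rewrite eqn_leq le//=.
  have vK w : vshift (- m) (vshift m w) = w.
    by case: w => a b'; rewrite /vshift /= addrK.
  rewrite -{1}(vK u) -{1}(vK v).
  have -> : c = (c \o eshift m) \o eshift (- m).
    apply/funext => -[[x y] z] /=; congr (c _); rewrite /eshift /vshift /=.
    by rewrite subrK.
  rewrite (_ : (_ \o eshift (- m)) \o eshift m = c \o eshift m); last first.
    apply/funext => -[[x y] z] /=; congr (c _); rewrite /eshift /vshift /=.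
    by rewrite subrK.
  apply: le; move: uv => [p [up lp sp]]; exists (map (vshift m) p).
  by rewrite path_vshift up last_map lp size_map sp.
move=> /(geodesicP (c' \o eshift m'))[up lp _ _].
rewrite {2}/dist -ptime_vshift; apply: dist_le_ptime; first by rewrite path_vshift.
by rewrite last_map lp.
Qed.

End first_passage.

(** * Mean and variance of passage times *)
Lemma vshiftD m n u : vshift m (vshift n u) = vshift (n + m) u.
Proof. by rewrite /vshift /= addrA. Qed.

(** The limit is the infimum of [m n / n]. Near a good [N], write [n] as a multiple of [N] plus a
    remainder, whose contribution is at most [B * N]. *)
Lemma fekete (R : realType) (m : nat -> R) (B : R) :
  (forall i j, m (i + j)%N <= m i + m j) -> (forall n, 0 <= m n <= B * n%:R) ->
  exists l : R, (fun n => m n / n%:R) @ \oo --> l.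
Proof.
move=> msub mB.
pose S := [set x | exists2 n, (0 < n)%N & x = m n / n%:R].
have S0 : lbound S 0.
  by move=> _ [n n0 ->]; rewrite divr_ge0//; case/andP: (mB n).
have iS : has_inf S by split; [exists (m 1%N / 1%:R), 1%N | exists 0].
exists (inf S); apply/cvgrPdist_le => e e0.
have e2 : 0 < e / 2 by rewrite divr_gt0.
have [_ [N N0 ->] NS] := inf_adherent e2 iS.
have N0' : 0 < N%:R :> R by rewrite ltr0n.
have mulN k r : m (k * N + r)%N <= k%:R * m N + m r.
  elim: k => [|k IH]; first by rewrite mul0r add0r.
  rewrite mulSn -addnA; apply: le_trans (msub _ _) _; rewrite -addn1 natrD; lra.
have B0 : 0 <= B by case/andP: (mB 1%N); rewrite mulr1; exact: le_trans.
near=> n.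
have n0 : (0 < n)%N by near: n; exact: nbhs_infty_gt.
have n0' : 0 < n%:R :> R by rewrite ltr0n.
(* Beyond this threshold the remainder term [B * N] is at most [n * e / 2]. *)
have nbig : 2 * B * N%:R / e <= n%:R by near: n; exact: nbhs_infty_ger.
have lo : inf S <= m n / n%:R by apply: ge_inf; [exists 0 | exists n].
rewrite distrC ger0_norm ?subr_ge0// lerBlDr ler_pdivrMr//.
have /andP[mr0 mrB] := mB (n %% N)%N.
have h1 := mulN (n %/ N)%N (n %% N)%N; rewrite -divn_eq in h1.
have h2 : m (n %% N)%N <= B * N%:R.
  by apply: le_trans mrB _; rewrite ler_wpM2l// ler_nat ltnW// ltn_mod.
have h3 : (n %/ N)%:R * m N <= n%:R * (m N / N%:R).
  rewrite mulrA ler_pdivlMr// mulrAC ler_wpM2r//; first by case/andP: (mB N).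
  by rewrite -natrM ler_nat leq_trunc_div.
have h4 : n%:R * (m N / N%:R) <= n%:R * (inf S + e / 2) by rewrite ler_wpM2l// ltW.
move: nbig; rewrite ler_pdivrMr// => nbig.
by nra.
Unshelve. all: by end_near.
Qed.

Section mean_passage_time.
Variables (R : realType) (q : R) (wt : edge -> bool -> nat) (b : nat).
Hypothesis q01 : 0 <= q <= 1.
Hypothesis wt_gt0 : forall e x, (0 < wt e x)%N.
Hypothesis wt_le : forall e x, (wt e x <= b)%N.
Hypothesis wt_mono : forall e, (wt e false <= wt e true)%N.
Hypothesis wt_shift : forall m e x, wt (eshift m e) x = wt e x.

Let d u v (c : edge -> bool) : R := (dist wt u v c)%:R.

Definition mean_dist u v : R := cyl_expect q (fun c => (dist wt u v c)%:R).

Lemma distR_depends u v k : reach u v k -> depends_on (edge_ball u (b * k)) (d u v).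
Proof. by move=> /(dist_depends wt_gt0 wt_le) H c c' cc'; rewrite /d (H c c'). Qed.

Lemma mean_distE s u v k c : reach u v k -> {subset edge_ball u (b * k) <= s} ->
  mean_dist u v = expect q s (d u v) c.
Proof.
move=> uv sub; apply: cyl_expectE; apply: depends_on_sub sub _; exact: distR_depends.
Qed.

Lemma mean_dist_triangle u v w k l : reach u v k -> reach v w l ->
  mean_dist u w <= mean_dist u v + mean_dist v w.
Proof.
move=> uv vw; have uw := reach_trans uv vw.
pose s := edge_ball u (b * (k + l)) ++ edge_ball u (b * k) ++ edge_ball v (b * l).
have c : edge -> bool := fun=> false.
rewrite (@mean_distE s _ _ _ c uv) ?(@mean_distE s _ _ _ c vw) ?(@mean_distE s _ _ _ c uw);
  try by move=> e es; rewrite !mem_cat es ?orbT.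
rewrite -[leRHS](congr1 (@^~ c) (expectD _ _ _ _)).
by apply: ler_expect => // x; rewrite -natrD ler_nat; exact: dist_triangle uv vw.
Qed.

Lemma mean_dist_bounds u v k : reach u v k -> 0 <= mean_dist u v <= (b * k)%:R.
Proof.
move=> uv; pose c : edge -> bool := fun=> false; rewrite (@mean_distE _ _ _ _ c uv (fun=> id)).
rewrite expect_ge0//= -[leRHS](congr1 (@^~ c) (expect_cst q (edge_ball u (b * k)) _)).
by apply: ler_expect => // x; rewrite ler_nat; exact: dist_le.
Qed.

Lemma mean_dist_vshift m u v k : reach u v k ->
  mean_dist (vshift m u) (vshift m v) = mean_dist u v.
Proof.
move=> uv; pose c : edge -> bool := fun=> false; set s := edge_ball u (b * k).
rewrite (@mean_distE s u v k c uv (fun=> id)).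
have -> : c = c \o eshift m by [].
rewrite -(@expect_reindex _ _ q _ _ _ c (@eshift_inj m)).
have -> : (fun c0 => d u v (c0 \o eshift m)) = d (vshift m u) (vshift m v).
  by apply/funext => x; rewrite /d (dist_vshift wt_shift m _ uv).
apply: cyl_expectE => x y xy.
rewrite !(dist_vshift wt_shift m _ uv); apply: (distR_depends uv) => e es /=.
by apply: xy; exact: map_f.
Qed.

(** By Efron-Stein, each edge contributes at most [b ^ 2] times the probability that the geodesic
    uses it. Summing over edges gives the mean geodesic length, at most [b * k]. *)
Lemma variance_dist_le u v k c : reach u v k ->
  variance_on q (edge_ball u (b * k)) (d u v) c <= (b ^ 3 * k)%:R.
Proof.
move=> uv; set s := edge_ball _ _; have us : uniq s by exact: undup_uniq.
case/andP: (q01) => q0 q1; have q1' : 0 <= 1 - q by rewrite subr_ge0.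
pose g c := path_edges u (geodesic wt c u v).
apply: le_trans (efron_stein q01 _ _ us) _.
apply: (@le_trans _ _ (\sum_(e <- s) expect q s (fun c => (b ^ 2 * (e \in g c))%:R) c)).
  rewrite big_seq [leRHS]big_seq; apply: ler_sum => e es.
  apply: (@le_trans _ _ ((1 - q) * expect q s (fun c => discrete_diff e (d u v) c ^+ 2) c)).
    rewrite ler_wpM2r ?expect_ge0//; first by move=> ?; rewrite sqr_ge0.
    by rewrite ler_piMl.
  (* The remaining factor [1 - q] is the probability of a low bit at [e]. Resampling that bit on the
     right produces the same factor in front of the low configuration, where [dist_upd] applies. *)
  rewrite -[leRHS](congr1 (@^~ c) (expect_resample q _ es)) -[leLHS](congr1 (@^~ c) (expectZ _ _ _ _)).
  apply: ler_expect => // x; rewrite /resample.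
  have /andP[lo up] := dist_upd wt_le wt_mono x e uv.
  rewrite -[leLHS]add0r; apply: lerD; first by rewrite mulr_ge0.
  rewrite ler_wpM2l// natrM natrX; rewrite -/(g _) in up *.
  have -> : (e \in g (upd x e false))%:R = ((e \in g (upd x e false))%:R : R) ^+ 2.
    by case: (_ \in _); rewrite ?expr1n ?expr0n.
  rewrite -exprMn ler_sqr ?nnegrE ?mulr_ge0// /discrete_diff /d ?subr_ge0 ?ler_nat//.
  by rewrite lerBlDl -natrM -natrD ler_nat.
rewrite -[leLHS](congr1 (@^~ c) (expect_sum _ _ _ _)).
rewrite -[leRHS](congr1 (@^~ c) (expect_cst q s _)); apply: ler_expect => // x.
rewrite -natr_sum ler_nat -big_distrr /= (expnSr b 2) -mulnA leq_mul2l; apply/orP; right.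
apply: leq_trans (size_geodesic wt_gt0 wt_le x uv); rewrite -(size_pairmap edge_of u).
rewrite -/(path_edges _ _) -/(g x).
have -> : (\sum_(e <- s) (e \in g x) = size [seq e <- s | e \in g x])%N.
  by rewrite size_filter -sum1_count [RHS]big_mkcond; apply: eq_bigr => e _ /=; case: (e \in g x).
by apply: uniq_leq_size => [|e]; [rewrite filter_uniq | rewrite mem_filter => /andP[]].
Qed.

Lemma dist_chebyshev u v k c (x : R) : 0 < x -> reach u v k ->
  expect q (edge_ball u (b * k)) (fun c => ((x <= `|d u v c - mean_dist u v|)%R)%:R) c
    <= (b ^ 3 * k)%:R / x ^+ 2.
Proof.
move=> x0 uv; have mE := mean_distE c uv (fun=> id).
apply: le_trans (chebyshev_expect q01 x0 (esym mE)) _.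
by rewrite ler_wpM2r ?invr_ge0 ?sqr_ge0//; exact: variance_dist_le.
Qed.

Lemma mean_dist_cvg u :
  exists l : R, (fun n => mean_dist u (vshift n%:Z u) / n%:R) @ \oo --> l.
Proof.
apply: (@fekete _ _ b%:R) => [i j|n].
  have E : vshift (i + j)%N%:Z u = vshift j%:Z (vshift i%:Z u) by rewrite vshiftD PoszD.
  rewrite E; apply: le_trans (mean_dist_triangle (reach_up u i) (reach_up _ j)) _.
  by rewrite lerD2l vshiftD addrC -vshiftD (mean_dist_vshift _ (reach_up u j)).
by rewrite -natrM; exact: mean_dist_bounds (reach_up u n).
Qed.

End mean_passage_time.

(** * Measurability and transfer to the probability space *)
(** There are countably many paths, but arbitrary real weights may leave the path times unbounded
    below, where [inf] takes its default value 0. The preimage of a half-line is split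
    accordingly. *)
Lemma passage_time_measurable (R : realType) (d : measure_display) (Omega : measurableType d)
    (tau : edge -> Omega -> R) u v :
  (forall e, measurable_fun setT (tau e)) -> measurable_fun setT (passage_time tau u v).
Proof.
move=> mtau.
have mpt p : measurable_fun setT (path_time tau u p) by exact: measurable_sum.
pose good (p : seq vertex) := path adj u p && (last u p == v).
pose S w := [set t : R | exists p, [/\ path adj u p, last u p = v & t = path_time tau u p w]].
have SP w t : S w t <-> exists2 p, good p & t = path_time tau u p w.
  split=> [[p [up lp tE]]|[p /andP[up /eqP lp] tE]]; exists p => //.
  by rewrite /good up lp eqxx.
have [[p0 gp0]|nogood] := pselect (exists p, good p); last first.
  rewrite (_ : passage_time tau u v = fun=> inf set0); first exact: measurable_cst.
  apply/funext => w; congr inf; apply/seteqP; split=> [t /SP[p gp _]|//].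
  by case: nogood; exists p.
(* Integer lower bounds suffice, which makes boundedness below a countable combination of events. *)
pose low m (p : seq vertex) := if good p then [set w | - m%:R <= path_time tau u p w] else setT.
pose Low := \bigcup_(m : nat) \bigcap_(p : seq vertex) low m p.
have mbigU (F : seq vertex -> set Omega) :
    (forall p, measurable (F p)) -> measurable (\bigcup_p F p).
  by move=> mF; apply: countable_bigcupT_measurable => //; exact: countableP.
have mle p y : measurable [set w | y <= path_time tau u p w].
  rewrite -[X in measurable X]setTI (_ : [set w | _] = path_time tau u p @^-1` `[y, +oo[).
    exact: mpt.
  by apply/seteqP; split=> w /=; rewrite in_itv /= andbT.
have mlt p y : measurable [set w | path_time tau u p w < y].
  rewrite (_ : [set w | _] = ~` [set w | y <= path_time tau u p w]).
    exact: measurableC.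
  by apply/seteqP; split=> w /=; rewrite ltNge => /negP.
have mLow : measurable Low.
  apply: bigcupT_measurable => m.
  rewrite -[X in measurable X]setCK setC_bigcap; apply: measurableC; apply: mbigU => p.
  by apply: measurableC; rewrite /low; case: ifP.
have LowP w : Low w <-> has_lbound (S w).
  split=> [[m _ lowm]|[m lbm]].
    exists (- m%:R) => _ /SP[p gp ->]; by have := lowm p I; rewrite /low gp.
  exists (Num.trunc `|m|).+1 => // p _; rewrite /low; case: ifP => // gp /=.
  apply: (@le_trans _ _ m); last by apply: lbm; apply/SP; exists p.
  by rewrite lerNl; apply: le_trans (ltW (truncnS_gt _)); rewrite ler_normr lexx orbT.
move=> _; apply: (measurability _ (RGenInftyO.measurableE R)) => // _ [_ [x ->] <-].
rewrite setTI.
have -> : passage_time tau u v @^-1` `]-oo, x[ =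
    (Low `&` \bigcup_(p : seq vertex) (if good p then [set w | path_time tau u p w < x] else set0))
    `|` (~` Low `&` [set w | 0 < x]).
  apply/seteqP; split=> w; rewrite /= in_itv /=.
    have [Lw|nLw] := pselect (Low w); last first.
      rewrite /passage_time /inf sup_out ?oppr0; first by right.
      move=> [_ [y ub]]; apply: nLw; apply/LowP; exists (- y) => t St.
      by rewrite lerNl; apply: ub; exists t.
    move=> infx; left; split=> //.
    have hS : has_inf (S w).
      by split; [exists (path_time tau u p0 w); apply/SP; exists p0 | apply/LowP].
    have e0 : 0 < x - passage_time tau u v w by rewrite subr_gt0.
    have [_ /SP[p gp ->]] := inf_adherent e0 hS.
    by rewrite addrC subrK => ?; exists p; rewrite ?gp.
  case=> [[/LowP Lw [p _]]|[nLw x0]].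
    case: ifP => // gp /= px; apply: le_lt_trans px; apply: ge_inf => //.
    by apply/SP; exists p.
  rewrite /passage_time /inf sup_out ?oppr0// => -[_ [y ub]]; apply: nLw; apply/LowP.
  by exists (- y) => t St; rewrite lerNl; apply: ub; exists t.
apply: measurableU; apply: measurableI => //.
- by apply: mbigU => p; case: ifP.
- exact: measurableC.
- have [x0|x0] := pselect (0 < x).
    by rewrite (_ : [set _ | _] = setT) //; apply/seteqP; split.
  by rewrite (_ : [set _ | _] = set0) //; apply/seteqP; split=> w /=.
Qed.

(** * Joint law of finitely many random bits *)

Section bits.
Variables (R : realType) (d : measure_display) (Omega : measurableType d).
Variables (P : probability Omega R) (I : choiceType) (q : R) (bits : Omega -> I -> bool).

Let pr (x : bool) : R := if x then q else 1 - q.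

Hypothesis mbits : forall e x, measurable [set w | bits w e = x].
Hypothesis Pbits : forall t c, uniq t ->
  P [set w | forall e, e \in t -> bits w e = c e] = (\prod_(e <- t) pr (c e))%:E.

Let cyl (s t : seq I) (A : (I -> bool) -> bool) c := [set w |
  A (fun e => if e \in s then bits w e else c e) /\ forall e, e \in t -> bits w e = c e].

Let measurable_cyl0 (t : seq I) c : measurable [set w | forall e, e \in t -> bits w e = c e].
Proof.
elim: t => [|e t IH].
  by rewrite (_ : [set _ | _] = setT) //; apply/seteqP; split.
rewrite (_ : [set _ | _] = [set w | bits w e = c e] `&` [set w | forall e, e \in t -> bits w e = c e]).
  exact: measurableI.
apply/seteqP; split=> w /=.
  move=> h; split=> [|e' e't]; apply: h; rewrite inE ?eqxx ?e't ?orbT//.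
by move=> [he ht] e'; rewrite inE => /predU1P[-> //|/ht].
Qed.

(** The induction moves one coordinate at a time from the free list [s] to the pinned list [t],
    splitting the event by the value of that bit; pinned bits contribute the product. *)
Lemma law_bits_cyl s t (A : (I -> bool) -> bool) c : uniq (s ++ t) ->
  measurable (cyl s t A c) /\
  P (cyl s t A c) = (expect q s (fun c => (A c)%:R) c * \prod_(e <- t) pr (c e))%:E.
Proof.
elim: s t c => [|e s IH] t c ust.
  have [Ac|nAc] := boolP (A c).
    rewrite (_ : cyl _ _ _ _ = [set w | forall e, e \in t -> bits w e = c e]).
      by rewrite Pbits// /= Ac mul1r.
    by apply/seteqP; split=> w /= => [[]|].
  rewrite (_ : cyl _ _ _ _ = set0) ?measure0.
    by rewrite /= (negbTE nAc) mul0r.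
  by apply/seteqP; split=> w // -[] /=; rewrite (_ : (fun e => _) = c) // (negbTE nAc).
have [es [et ust']] : e \notin s /\ e \notin t /\ uniq (s ++ e :: t).
  move: ust; rewrite cat_cons cons_uniq mem_cat negb_or => /andP[/andP[es et] ust]; split=> //.
  split=> //; rewrite -cat_rcons cat_uniq rcons_uniq es.
  move: ust; rewrite cat_uniq => /and3P[-> + ->]; rewrite /= andbT => h.
  by apply/hasPn => x xt; rewrite mem_rcons inE negb_or (memPn et)//; exact: (hasPn h).
have cylE : cyl (e :: s) t A c = cyl s (e :: t) A (upd c e true) `|` cyl s (e :: t) A (upd c e false).
  have key w x : bits w e = x -> (cyl s (e :: t) A (upd c e x) w <-> cyl (e :: s) t A c w).
    move=> wx.
    have -> : cyl s (e :: t) A (upd c e x) w =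
      (A (fun e' => if e' \in s then bits w e' else upd c e x e') /\
       forall e', e' \in e :: t -> bits w e' = upd c e x e') by [].
    have -> : (fun e' => if e' \in s then bits w e' else upd c e x e') =
        (fun e' => if e' \in e :: s then bits w e' else c e').
      apply/funext => e'; rewrite inE /upd; case: eqP => [->|//].
      by rewrite (negbTE es) wx.
    split=> -[Aw h]; split=> // e' e't.
      by rewrite h ?inE ?e't ?orbT// /upd; case: eqP et => // <-; rewrite e't.
    rewrite /upd; move: e't; rewrite inE; case: eqP => [->//|_ /= /h]; exact.
  apply/seteqP; split=> w.
    by case wx: (bits w e) => /(key _ _ wx); [left|right].
  case=> cw; [apply: (iffLR (key w true _) cw) | apply: (iffLR (key w false _) cw)];
    by case: cw => _ /(_ e); rewrite upd_same; apply; exact: mem_head.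
have [m1 p1] := IH (e :: t) (upd c e true) ust'.
have [m0 p0] := IH (e :: t) (upd c e false) ust'.
rewrite cylE; split; first exact: measurableU.
rewrite measureU//; last first.
  apply/seteqP; split=> w // -[[_ /(_ e (mem_head _ _))]]; rewrite upd_same => we.
  by move=> [_ /(_ e (mem_head _ _))]; rewrite upd_same we.
have prodE x : \prod_(e' <- t) pr (upd c e x e') = \prod_(e' <- t) pr (c e').
  by apply: eq_big_seq => e' e't; rewrite /upd; case: eqP et => // <-; rewrite e't.
rewrite [X in (X + _)%E]p1 [X in (_ + X)%E]p0 -EFinD !big_cons !upd_same !prodE; congr EFin.
by rewrite /= /resample /pr; ring.
Qed.

Lemma law_bits s (A : (I -> bool) -> bool) c : uniq s -> depends_on s A ->
  measurable [set w | A (bits w)] /\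
  P [set w | A (bits w)] = (expect q s (fun c => (A c)%:R) c)%:E.
Proof.
move=> us As; have := @law_bits_cyl s [::] A c; rewrite cats0 big_nil mulr1 => /(_ us).
suff -> : cyl s [::] A c = [set w | A (bits w)] by [].
have AE w : A (fun e => if e \in s then bits w e else c e) = A (bits w).
  by apply: As => e ->.
by apply/seteqP; split=> w /=; rewrite /cyl /= AE => // -[].
Qed.

End bits.

(** * Limits of the passage times *)
(** Between consecutive fourth powers both sequences move by O(k^3), the size of the allowed
    deviation, and this is negligible against k^4. *)
Lemma cvg_interpolate (R : realType) (D m : nat -> R) (B l : R) (K0 : nat) :
  (forall i k, `|D (i + k)%N - D i| <= B * k%:R) ->
  (forall i k, `|m (i + k)%N - m i| <= B * k%:R) ->
  (forall k, (K0 <= k)%N -> `|D (k ^ 4)%N - m (k ^ 4)%N| <= (k ^ 3)%:R) ->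
  (fun n => m n / n%:R) @ \oo --> l -> (fun n => D n / n%:R) @ \oo --> l.
Proof.
move=> DB mB Dm ml.
have B0 : 0 <= B by have := DB 0%N 1%N; rewrite mulr1; exact: le_trans.
have -> : (fun n => D n / n%:R) = (fun n => (D n - m n) / n%:R + m n / n%:R).
  by apply/funext => n; rewrite -mulrDl subrK.
rewrite -[l]add0r; apply: cvgD => //; apply/cvgr0Pnorm_le => e e0.
(* The constant [1 + 30 * B] is 1 for the deviation at [k ^ 4] plus [15 * B] for the variation of
   each sequence, all in units of k^3. *)
pose K1 := maxn (maxn K0 1) (Num.trunc ((1 + 30 * B) / e)).+1.
near=> n.
have nK : (K1 ^ 4 <= n)%N by near: n; exact: nbhs_infty_ge.
have bound k : (k ^ 4 <= n)%N -> (k <= n)%N.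
  by move=> kn; apply: leq_trans kn; case: k => // k; exact: (@leq_pexp2l k.+1 1 4).
case: (ex_maxnP (ex_intro (fun k => k ^ 4 <= n)%N K1 nK) bound) => k kn kmax.
have kK : (K1 <= k)%N by exact: kmax.
have nk : (n < k.+1 ^ 4)%N by rewrite ltnNge; apply/negP => /kmax; rewrite ltnn.
have [k0 [kK0 ke]] : (0 < k)%N /\ (K0 <= k)%N /\ (1 + 30 * B) / e <= k%:R.
  move: kK; rewrite !geq_max => /andP[/andP[-> ->] kt]; split=> //; split=> //.
  by apply: le_trans (ltW (truncnS_gt _)) _; rewrite ler_nat.
(* For k at least 1, (k+1)^4 - k^4 = 4k^3 + 6k^2 + 4k + 1 is at most 15k^3. *)
have gap : (n - k ^ 4)%:R <= 15 * (k ^ 3)%:R :> R.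
  rewrite -natrM ler_nat; move: nk kn k0; rewrite !expnS !expn0; nia.
have nE : n = (k ^ 4 + (n - k ^ 4))%N by rewrite subnKC.
have h1 := DB (k ^ 4)%N (n - k ^ 4)%N; have h2 := mB (k ^ 4)%N (n - k ^ 4)%N.
have h3 := Dm k kK0; rewrite -nE in h1 h2.
have h4 : B * (n - k ^ 4)%:R <= B * (15 * (k ^ 3)%:R) by rewrite ler_wpM2l.
have h5 : `|D n - m n| <= (1 + 30 * B) * (k ^ 3)%:R.
  have -> : D n - m n = (D n - D (k ^ 4)%N) + (D (k ^ 4)%N - m (k ^ 4)%N) - (m n - m (k ^ 4)%N) by ring.
  apply: le_trans (ler_normB _ _) _; apply: le_trans (lerD (ler_normD _ _) (lexx _)) _.
  by lra.
have n0 : 0 < n%:R :> R by rewrite ltr0n (leq_trans _ kn)// expn_gt0 k0.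
rewrite normrM normfV (ger0_norm (ltW n0)) ler_pdivrMr//; apply: le_trans h5 _.
have h6 : (k ^ 4)%:R <= n%:R :> R by rewrite ler_nat.
have h7 : 1 + 30 * B <= e * k%:R by rewrite (mulrC e) -ler_pdivrMr.
apply: (@le_trans _ _ (e * (k ^ 4)%:R)); last by rewrite ler_wpM2l// ltW.
by rewrite (expnS k 3) natrM mulrA ler_wpM2r.
Unshelve. all: by end_near.
Qed.

Section law_of_large_numbers.
Variables (R : realType) (q : R) (wt : edge -> bool -> nat) (b : nat).
Hypothesis q01 : 0 <= q <= 1.
Hypothesis wt_gt0 : forall e x, (0 < wt e x)%N.
Hypothesis wt_le : forall e x, (wt e x <= b)%N.
Hypothesis wt_mono : forall e, (wt e false <= wt e true)%N.
Variables (disp : measure_display) (Omega : measurableType disp) (P : probability Omega R).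
Variables (tau : edge -> Omega -> R) (L : edge -> probability R R).
Hypothesis indep : indep_edge_weights P tau L.
Hypothesis L_hi : forall e, L e [set (wt e true)%:R] = q%:E.
Hypothesis L_supp : forall e, L e [set x | x = (wt e true)%:R \/ x = (wt e false)%:R] = 1%E.

(** Bits are read off the weights by testing for the high value; anything else, almost surely the
    low value, counts as false. *)
Let bits (w : Omega) (e : edge) : bool := tau e w == (wt e true)%:R.
Let B e (x : bool) : set R := if x then [set (wt e true)%:R] else ~` [set (wt e true)%:R].

Let bitsE e x : [set w | bits w e = x] = tau e @^-1` B e x.
Proof.
case: x; apply/seteqP; split=> w; rewrite /bits /B /=.
- by move/eqP.
- by move=> ->; rewrite eqxx.
- by move=> h /eqP; rewrite h.
- by move=> /eqP/negbTE.
Qed.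

Let mB e x : measurable (B e x).
Proof. by rewrite /B; case: x; [|apply: measurableC]; exact: measurable_set1. Qed.

Let mbits e x : measurable [set w | bits w e = x].
Proof.
by case: indep => mtau _ _; rewrite bitsE -[X in measurable X]setTI; exact: mtau.
Qed.

Let Pbits t c : uniq t -> P [set w | forall e, e \in t -> bits w e = c e] =
  (\prod_(e <- t) (if c e then q else 1 - q))%:E.
Proof.
case: indep => mtau ltau itau ut.
have -> : [set w | forall e, e \in t -> bits w e = c e] =
    \big[setI/setT]_(e <- t) (tau e @^-1` B e (c e)).
  rewrite -bigcap_seq; apply/seteqP; split=> w /= h e et.
    by rewrite -bitsE; exact: h.
  by have := h e et; rewrite -bitsE.
rewrite (itau t (fun e => B e (c e)))// -prodEFin; apply: eq_bigr => e _.
rewrite ltau// /B; case: (c e); first exact: L_hi.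
rewrite probability_setC; last exact: measurable_set1.
by rewrite L_hi.
Qed.

(** Where every weight has one of its two prescribed values, the real infimum is the integer minimum
    [dist]. There are countably many edges, so the exceptional set is null. *)
Let regular : set Omega := [set w | forall e, tau e w = (wt e (bits w e))%:R].

Let ae_regular : P.-negligible (~` regular).
Proof.
case: indep => mtau ltau _.
pose S e : set R := [set x | x = (wt e true)%:R \/ x = (wt e false)%:R].
have mS e : measurable (S e).
  rewrite (_ : S e = [set (wt e true)%:R] `|` [set (wt e false)%:R])//.
  by apply: measurableU; exact: measurable_set1.
pose F n := if @unpickle edge n is Some e then tau e @^-1` ~` S e else set0.
apply: (@negligibleS _ _ _ _ (\bigcup_n F n)).
  move=> w /existsNP[e we]; exists (pickle e); [exact: I|]; rewrite /F pickleK => -[] eq; apply: we;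
    rewrite /bits eq ?eqxx//.
  by case: eqP => // <-.
apply: negligible_bigcup => n; rewrite /F; case: unpickle => [e|]; last exact: negligible_set0.
apply/negligibleP; first by rewrite -[X in measurable X]setTI; apply: mtau => //; exact: measurableC.
apply: (etrans (ltau e _ (measurableC (mS e)))).
by rewrite probability_setC// L_supp subee.
Qed.

Let passage_timeE w u v k : regular w -> reach u v k ->
  passage_time tau u v w = (dist wt u v (bits w))%:R.
Proof.
move=> rw uv.
have ptE p : path_time tau u p w = (ptime wt (bits w) u p)%:R.
  by rewrite /path_time /ptime natr_sum; apply: eq_bigr => e _; exact: rw.
have [up lp _ pmin] := geodesicP wt (bits w) uv.
rewrite /passage_time; set S := [set _ | _].
have lbS : lbound S (dist wt u v (bits w))%:R.
  by move=> _ [p [up' lp' ->]]; rewrite ptE ler_nat; exact: pmin.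
have Sd : S (dist wt u v (bits w))%:R by exists (geodesic wt (bits w) u v); rewrite ptE.
apply/eqP; rewrite eq_le; apply/andP; split.
  by apply: ge_inf => //; exists (dist wt u v (bits w))%:R.
by apply: lb_le_inf => //; exists (dist wt u v (bits w))%:R.
Qed.

Let dev u v (x : R) := [set w | x <= `|(dist wt u v (bits w))%:R - mean_dist q wt u v|].

Let dev_le u v k x : 0 < x -> reach u v k ->
  measurable (dev u v x) /\ (P (dev u v x) <= ((b ^ 3 * k)%:R / x ^+ 2)%:E)%E.
Proof.
move=> x0 uv.
pose A c := (x <= `|(dist wt u v c)%:R - mean_dist q wt u v|)%R.
have dA : depends_on (edge_ball u (b * k)) A.
  by move=> c c' cc'; rewrite /A (distR_depends R wt_gt0 wt_le uv cc').
have [m PE] := law_bits mbits Pbits (fun=> false) (undup_uniq _) dA.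
split=> //; rewrite [leLHS]PE lee_fin.
exact: (dist_chebyshev q01 wt_gt0 wt_le wt_mono _ x0 uv).
Qed.

(** Half of [eps] absorbs the convergence of the means; the other half is a deviation of order n,
    which Chebyshev bounds by O(1/n). *)
Lemma passage_time_cvg_in_probability u (l : R) :
  (fun n => mean_dist q wt u (vshift n%:Z u) / n%:R) @ \oo --> l ->
  forall eps : R, 0 < eps ->
  (fun n : nat => P [set w | eps <= `|passage_time tau u (vshift n%:Z u) w / n%:R - l|])
    @ \oo --> 0%E.
Proof.
move=> ml eps eps0; have e2 : 0 < eps / 2 by rewrite divr_gt0.
have [N [mN N0 subN]] := ae_regular.
have bnd : \forall n \near \oo,
    (P [set w | (eps <= `|passage_time tau u (vshift n%:Z u) w / n%:R - l|)%R] <=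
      ((b ^ 3)%:R / (eps / 2) ^+ 2 * n%:R^-1)%:E)%E.
  near=> n.
  have n0 : (0 < n)%N by near: n; exact: nbhs_infty_gt.
  have n0' : 0 < n%:R :> R by rewrite ltr0n.
  have mnl : `|l - mean_dist q wt u (vshift n%:Z u) / n%:R| <= eps / 2.
    by near: n; exact: (cvgrPdist_le _ _).1 ml _ e2.
  have x0 : 0 < eps / 2 * n%:R by rewrite mulr_gt0.
  have [mdev Pdev] := dev_le x0 (reach_up u n).
  (* The null set [N] is added because [passage_time] is known to equal [dist] only on regular
     outcomes. *)
  apply: (@le_trans _ _ (P (dev u (vshift n%:Z u) (eps / 2 * n%:R) `|` N))).
    apply: le_measure; rewrite ?inE; last 2 first.
    - exact: measurableU.
    - move=> w /= ew; have [rw|nrw] := pselect (regular w); last by right; exact: subN.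
      left; rewrite /dev /= -ler_pdivlMr//.
      have := passage_timeE rw (reach_up u n) => pE; rewrite pE in ew.
      move: ew mnl; set D := (dist _ _ _ _)%:R; set m := mean_dist _ _ _ _ => ew mnl.
      rewrite (_ : `|D - m| / n%:R = `|D / n%:R - m / n%:R|); last first.
        by rewrite -mulrBl normrM normfV (ger0_norm (ltW n0')).
      have := ler_normD (D / n%:R - m / n%:R) (m / n%:R - l).
      rewrite addrA subrK -[`|m / _ - l|]normrN opprB; lra.
    - case: indep => mtau _ _; rewrite -[X in measurable X]setTI.
      have := @passage_time_measurable _ _ _ tau u (vshift n%:Z u) mtau => mT.
      have mf : measurable_fun setT (fun w => `|passage_time tau u (vshift n%:Z u) w / n%:R - l|).
        apply: measurableT_comp => //; apply: measurable_funB => //.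
        by apply: measurable_funM.
      rewrite (_ : [set w | _] = (fun w => `|passage_time tau u (vshift n%:Z u) w / n%:R - l|) @^-1` `[eps, +oo[).
        exact: mf.
      by apply/seteqP; split=> w /=; rewrite in_itv /= andbT.
  apply: le_trans (measureU2 _ mdev mN) _; rewrite [X in (_ + X)%E]N0 adde0.
  apply: le_trans Pdev _; rewrite lee_fin natrM exprMn invfM.
  rewrite (_ : _ * _ * _ = (b ^ 3)%:R / (eps / 2) ^+ 2 * n%:R^-1)//.
  by field; rewrite !gt_eqF.
apply: (@squeeze_cvge _ _ _ _ (fun=> 0%E) _ (fun n : nat => ((b ^ 3)%:R / (eps / 2) ^+ 2 * n%:R^-1)%:E)).
- by near=> n; rewrite measure_ge0 /=; near: n; exact: bnd.
- exact: cvg_cst.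
- apply: cvg_EFin; first exact: nearW.
  rewrite -(mulr0 ((b ^ 3)%:R / (eps / 2) ^+ 2)); apply: cvgMr.
  by rewrite -cvg_shiftS; exact: cvg_harmonic.
Unshelve. all: by end_near.
Qed.

(** At n = k^4 a deviation k^3 has probability at most b^3 k^4 / k^6 = b^3 / k^2, which is summable.
    Borel-Cantelli handles this subsequence and interpolation the rest. *)
Lemma passage_time_cvg_ae u (l : R) :
  (fun n => mean_dist q wt u (vshift n%:Z u) / n%:R) @ \oo --> l ->
  {ae P, forall w, (fun n : nat => passage_time tau u (vshift n%:Z u) w / n%:R) @ \oo --> l}.
Proof.
move=> ml.
pose F k := dev u (vshift (k.+1 ^ 4)%N%:Z u) (k.+1 ^ 3)%:R.
have k3 k : 0 < (k.+1 ^ 3)%:R :> R by rewrite ltr0n expn_gt0.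
have mF k : measurable (F k) by have [] := dev_le (k3 k) (reach_up u (k.+1 ^ 4)).
have PF k : (P (F k) <= ((b ^ 3)%:R / (k.+1%:R ^+ 2))%:E)%E.
  have [_] := dev_le (k3 k) (reach_up u (k.+1 ^ 4)) => /le_trans; apply.
  rewrite lee_fin natrM !(natrX _ k.+1) le_eqVlt; apply/orP; left; apply/eqP.
  by field; rewrite (addrC 1) natr1 pnatr_eq0.
(* Telescoping: 1/x^2 is at most 2/x - 2/(x+1) for x at least 1. *)
have sumF n : (\sum_(0 <= k < n) P (F k) <= ((b ^ 3)%:R * (2 - 2 * n.+1%:R^-1))%:E)%E.
  elim: n => [|n IH].
    by rewrite big_geq// lee_fin mulr_ge0// invr1; lra.
  rewrite big_nat_recr//=; apply: le_trans (leeD IH (PF n)) _.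
  rewrite -EFinD lee_fin -mulrDr ler_wpM2l// -addrA lerD2l.
  have x1 : 1 <= n.+1%:R :> R by rewrite ler1n.
  rewrite -[n.+2%:R]natr1; move: x1; set x := n.+1%:R => x1.
  have x0 : 0 < x by lra.
  rewrite -subr_ge0 (_ : _ - _ = (x - 1) / (x ^+ 2 * (x + 1))).
    by rewrite divr_ge0 ?mulr_ge0 ?sqr_ge0//; lra.
  by field; rewrite !gt_eqF//; lra.
have Fsum : (\sum_(k <oo) P (F k) < +oo)%E.
  apply: (@le_lt_trans _ _ ((b ^ 3)%:R * 2)%:E); last exact: ltry.
  apply: lime_le; first exact: is_cvg_nneseries.
  apply: nearW => n; apply: le_trans (sumF n) _.
  by rewrite lee_fin ler_wpM2l// lerBlDr lerDl mulr_ge0// invr_ge0.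
have [N [mN N0 subN]] := ae_regular.
exists (N `|` lim_sup_set F); split.
- apply: measurableU => //; apply: bigcapT_measurable => n.
  by apply: bigcup_measurable => j _; exact: mF.
- apply/eqP; rewrite -measure_le0.
  have mlim : measurable (lim_sup_set F).
    by apply: bigcapT_measurable => n; apply: bigcup_measurable => j _; exact: mF.
  apply: le_trans (measureU2 _ mN mlim) _.
  by rewrite [X in (X + _)%E]N0 add0e [X in (X <= _)%E](lim_sup_set_cvg0 mF Fsum).
move=> w /= nw.
have [rw|nrw] := pselect (regular w); last by left; exact: subN.
have [|nlim] := pselect (lim_sup_set F w); first by right.
case: nw; move: nlim => /existsNP[K0 /not_implyP[_ nK]].
under eq_fun do rewrite (passage_timeE rw (reach_up u _)).
have close (g : nat -> R) : (forall i k, vshift (i + k)%N%:Z u = vshift k%:Z (vshift i%:Z u) ->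
    g (i + k)%N <= g i + (b * k)%:R /\ g i <= g (i + k)%N + (b * k)%:R) ->
    forall i k, `|g (i + k)%N - g i| <= b%:R * k%:R.
  move=> h i k; have [|h1 h2] := h i k; first by rewrite vshiftD PoszD.
  by rewrite ler_norml -natrM; apply/andP; split; lra.
(* [F k] controls the fourth power of [k.+1], so the threshold is shifted by one. *)
apply: (@cvg_interpolate _ _ (fun n => mean_dist q wt u (vshift n%:Z u)) b%:R l K0.+1) => //.
- apply: close => i k E; rewrite !E; have up := reach_up u i; have up' := reach_up (vshift i%:Z u) k.
  have down' := reach_down (vshift i%:Z u) k.
  split; rewrite -natrD ler_nat.
    by apply: leq_trans (dist_triangle wt _ up up') _; rewrite leq_add2l (dist_le wt_le).
  apply: leq_trans (dist_triangle wt _ (reach_trans up up') down') _.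
  by rewrite leq_add2l (dist_le wt_le).
- apply: close => i k E; rewrite !E; have up := reach_up u i; have up' := reach_up (vshift i%:Z u) k.
  have down' := reach_down (vshift i%:Z u) k.
  split.
    apply: le_trans (mean_dist_triangle q01 wt_gt0 wt_le up up') _.
    by rewrite lerD2l; case/andP: (mean_dist_bounds q01 wt_gt0 wt_le up').
  apply: le_trans (mean_dist_triangle q01 wt_gt0 wt_le (reach_trans up up') down') _.
  by rewrite lerD2l; case/andP: (mean_dist_bounds q01 wt_gt0 wt_le down').
- move=> [//|k] Kk; rewrite leNgt; apply/negP => /ltW Fk; apply: nK.
  by exists k.
Qed.

End law_of_large_numbers.

(** * The two-point laws and the strict inequality *)
(** Lets a known limit be bounded using multiples of 3 alone, where the block estimate is
    available. *)
Lemma cvg_le_frequently (R : realType) (a : nat -> R) (l x : R) :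
  a @ \oo --> l -> (forall N, exists2 n, (N <= n)%N & a n <= x) -> l <= x.
Proof.
move=> al fx; rewrite leNgt; apply/negP => xl.
have [N _ aN] : \forall n \near \oo, x < a n by apply: (cvgr_gt l).
by have [n Nn] := fx N; rewrite leNgt => /negP; apply; exact: aN.
Qed.

Section two_point_law.
Variables (R : realType) (q : R) (hi lo : R).

Definition two_point (x : bool) : R := if x then hi else lo.

Let measurable_two_point : measurable_fun setT two_point.
Proof. exact: measurable_fun_ifT. Qed.

HB.instance Definition _ := isMeasurableFun.Build _ _ _ _ two_point measurable_two_point.

Definition two_point_law : probability R R := distribution (bernoulli_prob q) two_point.

Hypothesis q01 : 0 <= q <= 1.

Lemma two_point_lawE (A : set R) :
  two_point_law A = (q * (hi \in A)%:R + (1 - q) * (lo \in A)%:R)%:E.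
Proof.
by rewrite /two_point_law /distribution /pushforward /= bernoulli_probE.
Qed.

Lemma two_point_law_hi : hi != lo -> two_point_law [set hi] = q%:E.
Proof.
move=> hl; rewrite two_point_lawE mem_set// memNset ?mulr1 ?mulr0 ?addr0//=.
by move=> /eqP; rewrite eq_sym (negbTE hl).
Qed.

Lemma two_point_law_full (A : set R) : A hi -> A lo -> two_point_law A = 1%E.
Proof. by move=> Ah Al; rewrite two_point_lawE !mem_set// !mulr1 addrC subrK. Qed.

Lemma two_point_law_not_point_mass : 0 < q < 1 -> hi != lo -> not_point_mass two_point_law.
Proof.
move=> /andP[q0 q1] hl x /(_ _ (measurable_set1 hi)); rewrite two_point_law_hi// diracE.
by case: (_ \in _) => -[] qE; move: q0 q1; rewrite qE ltxx.
Qed.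

Lemma two_point_law_bounded : 0 <= hi -> 0 <= lo -> bounded_nonneg_law two_point_law.
Proof.
move=> h0 l0; exists (Num.max hi lo); apply: two_point_law_full => /=.
  by rewrite h0 le_max lexx.
by rewrite l0 le_max lexx orbT.
Qed.

End two_point_law.

(** The left law takes two values only to be non-degenerate. On the right the value 1 is too rare to
    make the half-plane medium fast by itself. *)
Definition weight_neg (A : nat) (x : bool) : nat := if x then A.+1 else A.
Definition weight_pos (A : nat) (x : bool) : nat := if x then (2 * A)%N else 1.
Definition weight_inhom (A : nat) (e : edge) : bool -> nat :=
  if edge_neg e then weight_neg A else weight_pos A.

Section weights.
Variable A : nat.
Hypothesis A_gt1 : (1 < A)%N.

Lemma weight_neg_gt0 x : (0 < weight_neg A x)%N.
Proof. by rewrite /weight_neg; case: x => //; apply: ltn_trans A_gt1. Qed.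

Lemma weight_pos_gt0 x : (0 < weight_pos A x)%N.
Proof. by rewrite /weight_pos; case: x => //; rewrite muln_gt0 (ltn_trans _ A_gt1). Qed.

Lemma weight_neg_le x : (weight_neg A x <= 2 * A)%N.
Proof. by rewrite /weight_neg; case: x; lia. Qed.

Lemma weight_pos_le x : (weight_pos A x <= 2 * A)%N.
Proof. by rewrite /weight_pos; case: x; lia. Qed.

Lemma weight_inhom_gt0 e x : (0 < weight_inhom A e x)%N.
Proof. by rewrite /weight_inhom; case: ifP => _; [exact: weight_neg_gt0|exact: weight_pos_gt0]. Qed.

Lemma weight_inhom_le e x : (weight_inhom A e x <= 2 * A)%N.
Proof. by rewrite /weight_inhom; case: ifP => _; [exact: weight_neg_le|exact: weight_pos_le]. Qed.

Lemma weight_inhom_shift m e x : weight_inhom A (eshift m e) x = weight_inhom A e x.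
Proof. by rewrite /weight_inhom edge_neg_eshift. Qed.

End weights.

Lemma vshift_size_ge u p n : path adj u p -> last u p = vshift n%:Z u -> (n <= size p)%N.
Proof.
move=> up lp; have := last_adj_dist up; rewrite lp /= (addrC u.2) addrK; exact.
Qed.

(** * Bounds on mean passage times in the three media *)

Section strict_inequality.
Variables (R : realType) (A : nat).
Hypothesis A_gt1 : (1 < A)%N.

Let q : R := 255 / 256.
Let b := (2 * A)%N.

Let q01 : 0 <= q <= 1.
Proof. by rewrite /q; apply/andP; split; lra. Qed.

Let origin : vertex := (0%:Z, 0%:Z).

Lemma mean_dist_neg_ge u n :
  A%:R * n%:R <= mean_dist q (fun=> weight_neg A) u (vshift n%:Z u) :> R.
Proof.
have un := reach_up u n; pose c : edge -> bool := fun=> false.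
rewrite (mean_distE q (fun=> weight_neg_gt0 A_gt1) (fun=> weight_neg_le A_gt1) c un (fun=> id)).
rewrite -[leLHS](congr1 (@^~ c) (expect_cst q (edge_ball u (b * n)) _)).
apply: ler_expect => // c'; rewrite -natrM ler_nat.
have [up lp _ _] := geodesicP (fun=> weight_neg A) c' un.
apply: (@leq_trans (A * size (geodesic (fun=> weight_neg A) c' u (vshift n u)))).
  by rewrite leq_mul2l (vshift_size_ge up lp) orbT.
rewrite -(size_pairmap edge_of u) -sum1_size big_distrr /=.
by apply: leq_sum => e _; rewrite muln1 /weight_neg; case: (c' e).
Qed.

(** Chernoff factors: their mean is 255/256 * 1/16 + 1/256 * 16 = 511/4096, just below 1/8, which
    beats the path count [4 ^ n]. *)
Let tilt (x : bool) : R := if x then 16^-1 else 16.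

(* A path of [n] edges of total weight below [A * n] has fewer than [n / 2]
   expensive edges, so the product of its tilts is at least 1. *)
Lemma cheap_path_tilt s (c : edge -> bool) :
  (\sum_(e <- s) weight_pos A (c e) < A * size s)%N -> 1 <= \prod_(e <- s) tilt (c e).
Proof.
(* The product of tilts is 16 to the number of edges minus twice the number of expensive ones. *)
have tE : \prod_(e <- s) tilt (c e) * 16 ^+ (2 * \sum_(e <- s) c e)%N = 16 ^+ size s.
  elim: s => [|e s IH]; first by rewrite !big_nil mulr1.
  rewrite !big_cons /= exprS -IH mulnDr exprD /tilt; case: (c e) => /=.
    by rewrite muln1; field.
  by rewrite muln0 expr0; ring.
have wE : (2 * A * \sum_(e <- s) c e <= \sum_(e <- s) weight_pos A (c e))%N.
  rewrite big_distrr /=; apply: leq_sum => e _; rewrite /weight_pos; case: (c e) => /=.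
    by rewrite muln1.
  by rewrite muln0.
move=> ws; have {}wE := leq_ltn_trans wE ws.
have ts : (2 * \sum_(e <- s) c e <= size s)%N.
  by rewrite ltnW// -(@ltn_pmul2l A) ?(ltn_trans _ A_gt1)// mulnCA mulnA.
have x0 : 0 < 16 ^+ (2 * \sum_(e <- s) c e)%N :> R by rewrite exprn_gt0.
by rewrite -(ler_pM2r x0) mul1r tE ler_weXn2l// ler1n.
Qed.

(** Pointwise, the passage time is at least [A * n] times 1 minus the sum of the tilts of
    edge-simple paths: if it is below [A * n], some cheap path has tilt at least 1 and the bound is
    not positive. The mean of the sum is at most [4 ^ n * 8^-1 ^+ n]. *)
Lemma mean_dist_pos_ge u n :
  A%:R * n%:R * (1 - 2^-1 ^+ n) <= mean_dist q (fun=> weight_pos A) u (vshift n%:Z u) :> R.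
Proof.
have un := reach_up u n; pose c : edge -> bool := fun=> false.
rewrite (mean_distE q (fun=> weight_pos_gt0 A_gt1) (fun=> weight_pos_le A_gt1) c un (fun=> id)).
set s := edge_ball u (b * n); set d := dist _ _ _.
(* Distinct edges are required for the mean of a product of tilts to factor. *)
pose good := [seq p <- paths_from u n | uniq (path_edges u p)].
pose tilts (c : edge -> bool) : R := \sum_(p <- good) \prod_(e <- path_edges u p) tilt (c e).
have goodP p : p \in good -> [/\ path adj u p, size p = n & uniq (path_edges u p)].
  by rewrite mem_filter => /andP[up /size_mem_paths_from[]].
have tilts_ge0 c' : 0 <= tilts c'.
  by apply: sumr_ge0 => p _; apply: prodr_ge0 => e _; rewrite /tilt; case: (c' e).
have pw c' : A%:R * n%:R * (1 - tilts c') <= (d c')%:R.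
  have An0 : 0 <= A%:R * n%:R :> R by rewrite mulr_ge0.
  have [dn|dn] := leqP (A * n) (d c').
    apply: (@le_trans _ _ (A%:R * n%:R)); last by rewrite -natrM ler_nat.
    by rewrite ler_piMr// lerBlDr lerDl.
  apply: (@le_trans _ _ 0); last exact: ler0n.
  rewrite mulr_ge0_le0// subr_le0.
  have [up lp unp _] := geodesicP (fun=> weight_pos A) c' un.
  have szn := vshift_size_ge up lp; rewrite /d /dist in dn.
  set g := geodesic _ _ _ _ in up lp unp szn dn.
  (* The geodesic may have more than [n] edges; its first [n] edges already cost less than
     [A * n]. *)
  have gE : path_edges u g = path_edges u (take n g) ++ path_edges (last u (take n g)) (drop n g).
    by rewrite -path_edges_cat cat_take_drop.
  have ut : path adj u (take n g) by move: up; rewrite -{1}(cat_take_drop n g) cat_path => /andP[].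
  have st : size (take n g) = n by rewrite size_takel.
  have tg : take n g \in good.
    have tm : take n g \in paths_from u n by have := mem_paths_from ut; rewrite st.
    rewrite mem_filter tm andbT.
    by have := uniq_path_edges up unp; rewrite gE cat_uniq => /andP[].
  rewrite /tilts (big_rem _ tg) /= -[leLHS]addr0; apply: lerD; last first.
    by apply: sumr_ge0 => p _; apply: prodr_ge0 => e _; rewrite /tilt; case: (c' e).
  apply: cheap_path_tilt; rewrite size_pairmap st; apply: leq_ltn_trans dn.
  by rewrite /ptime gE big_cat leq_addr.
apply: (@le_trans _ _ (expect q s (fun c' => A%:R * n%:R * (1 - tilts c')) c)); last exact: ler_expect.
rewrite [leRHS](congr1 (@^~ c) (expectZ _ _ _ _)) ler_wpM2l ?mulr_ge0//.
have -> : (fun c' => 1 - tilts c') = (fun c' => 1 + (-1) * tilts c').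
  by apply/funext => c'; rewrite mulN1r.
rewrite expectD expectZ expect_cst expect_sum mulN1r lerD2l lerN2.
apply: (@le_trans _ _ (\sum_(p <- good) 8^-1 ^+ n)).
  rewrite big_seq [leRHS]big_seq; apply: ler_sum => p /goodP[up sp uep].
  have dep t : {subset path_edges u p <= t} ->
      depends_on t (fun c' => \prod_(e <- path_edges u p) tilt (c' e)).
    by move=> sub x y xy; apply: eq_big_seq => e /sub /xy ->.
  rewrite (@expect_indep _ _ q s (path_edges u p) _ c c); last 2 first.
  - by apply: dep; apply: mem_edge_ball => //; rewrite sp leq_pmull// muln_gt0 (ltn_trans _ A_gt1).
  - exact: dep.
  rewrite expect_prod// size_pairmap sp; apply: lerXn2r; rewrite ?nnegrE /tilt /q; lra.
rewrite big_const_seq count_predT iter_addr_0 -[leLHS]mulr_natl.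
apply: (@le_trans _ _ ((4 ^ n)%:R * 8^-1 ^+ n)).
  rewrite ler_wpM2r ?exprn_ge0// ler_nat -(size_paths_from u n) size_filter; exact: count_size.
by rewrite natrX -exprMn (_ : 4 * 8^-1 = 2^-1 :> R)//; field.
Qed.

Let left0 : vertex := (-1, 0%:Z).

(* Three units up the column [-1] cost at most [3 * (A + 1)], but only
   [2 * (A + 1) + 3] through column [0] when its three edges are cheap. *)
Lemma mean_dist_left_block :
  mean_dist q (weight_inhom A) left0 (vshift 3%:Z left0) <=
    3 * A%:R + 3 - 256^-1 ^+ 3 * (A%:R - 2) :> R.
Proof.
pose col : seq edge := [:: ((0%:Z, 0%:Z), false); ((0%:Z, 1%:Z), false); ((0%:Z, 2%:Z), false)].
have r3 := reach_up left0 3; pose c : edge -> bool := fun=> false.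
pose s := edge_ball left0 (b * 3) ++ col.
rewrite (@mean_distE _ q _ _ (weight_inhom_gt0 A_gt1) (weight_inhom_le A_gt1) s _ _ _ c r3); last first.
  by move=> e; rewrite mem_cat => ->.
pose cheap (x : bool) : R := if x then 0 else 1.
have A2 : 0 <= A%:R - 2 :> R by rewrite subr_ge0 ler_nat.
(* The product is the indicator that the detour is open; it then saves (3A + 3) - (2A + 5) = A -
   2. *)
pose f (c : edge -> bool) : R :=
  (3 * A%:R + 3) + (- (A%:R - 2)) * \prod_(e <- col) cheap (c e).
apply: (@le_trans _ _ (expect q s f c)).
  apply: ler_expect => // c'; rewrite /f.
  have straight : (dist (weight_inhom A) left0 (vshift 3%:Z left0) c' <= 3 * A + 3)%N.
    apply: leq_trans (dist_le_ptime _ _ (p := [:: (-1, 1%:Z); (-1, 2%:Z); (-1, 3%:Z)]) _ _) _ => //.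
    rewrite /ptime /path_edges /= !big_cons big_nil /weight_inhom /= /weight_neg.
    by do ![case: ifP => _]; lia.
  have [/and3P[/negbTE c0 /negbTE c1 /negbTE c2]|exp] :=
      boolP [&& ~~ c' ((0%:Z, 0%:Z), false), ~~ c' ((0%:Z, 1%:Z), false) & ~~ c' ((0%:Z, 2%:Z), false)].
    have detour : (dist (weight_inhom A) left0 (vshift 3%:Z left0) c' <= 2 * A + 5)%N.
      apply: leq_trans (dist_le_ptime _ _
        (p := [:: (0%:Z, 0%:Z); (0%:Z, 1%:Z); (0%:Z, 2%:Z); (0%:Z, 3%:Z); (-1, 3%:Z)]) _ _) _ => //.
      rewrite /ptime /path_edges /= !big_cons big_nil /weight_inhom /= /weight_neg /weight_pos.
      by rewrite /edge_of /= ?c0 ?c1 ?c2; do ![case: ifP => _]; lia.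
    rewrite !big_cons big_nil c0 c1 c2 /cheap !mulr1.
    have : (dist (weight_inhom A) left0 (vshift 3%:Z left0) c')%:R <= (2 * A + 5)%:R :> R by rewrite ler_nat.
    by rewrite natrD natrM; lra.
  have -> : \prod_(e <- col) cheap (c' e) = 0.
    rewrite !big_cons big_nil /cheap; move: exp.
    case: (c' ((0%:Z, 0%:Z), false)) => /=; first by rewrite mul0r.
    case: (c' ((0%:Z, 1%:Z), false)) => /=; first by rewrite mul0r mulr0.
    by case: (c' ((0%:Z, 2%:Z), false)) => //=; rewrite mul0r !mulr0.
  by rewrite mulr0 addr0 -natrM -natrD ler_nat.
rewrite /f expectD expectZ !expect_cst.
rewrite (@expect_indep _ _ q s col _ c c); last 2 first.
- by move=> x y xy; apply: eq_big_seq => e ec; rewrite xy// mem_cat ec orbT.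
- by move=> x y xy; apply: eq_big_seq => e ec; rewrite xy.
by rewrite expect_prod// /cheap mulr0 add0r mulr1 /q (_ : 1 - 255 / 256 = 256^-1 :> R); [lra|field].
Qed.

(** Step to column -1, climb [k] blocks, step back. The two horizontal edges cost at most [b] each,
    and the blocks are vertical translates with equal means. *)
Lemma mean_dist_inhom_le k :
  mean_dist q (weight_inhom A) origin (vshift (3 * k)%N%:Z origin) <=
    2 * b%:R + k%:R * (3 * A%:R + 3 - 256^-1 ^+ 3 * (A%:R - 2)) :> R.
Proof.
pose mean := mean_dist q (weight_inhom A).
have tri u v w i j : reach u v i -> reach v w j -> mean u w <= mean u v + mean v w.
  by move=> uv vw; apply: (mean_dist_triangle q01 (weight_inhom_gt0 A_gt1) (weight_inhom_le A_gt1) uv vw).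
have step u v : adj u v -> mean u v <= b%:R.
  move=> /reach_adj uv; have := mean_dist_bounds q01 (weight_inhom_gt0 A_gt1) (weight_inhom_le A_gt1) uv.
  by rewrite muln1 => /andP[].
have column n : mean left0 (vshift (3 * n)%N%:Z left0) <=
    n%:R * mean left0 (vshift 3%:Z left0).
  elim: n => [|n IH].
    have := mean_dist_bounds q01 (weight_inhom_gt0 A_gt1) (weight_inhom_le A_gt1) (reach_up left0 0).
    by rewrite !muln0 mul0r => /andP[].
  have E : vshift (3 * n.+1)%N%:Z left0 = vshift (3 * n)%N%:Z (vshift 3%:Z left0).
    by rewrite vshiftD mulnS PoszD.
  have E' : mean (vshift (3 * n)%N%:Z left0) (vshift (3 * n)%N%:Z (vshift 3%:Z left0)) =
      mean left0 (vshift 3%:Z left0).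
    by apply: (mean_dist_vshift q (weight_inhom_gt0 A_gt1) (weight_inhom_le A_gt1) (weight_inhom_shift A) _ (reach_up left0 3)).
  have r : reach (vshift (3 * n)%N%:Z left0) (vshift (3 * n)%N%:Z (vshift 3%:Z left0)) 3.
    by rewrite vshiftD addrC -vshiftD; exact: reach_up.
  rewrite E; apply: le_trans (tri _ _ _ _ _ (reach_up left0 _) r) _.
  by rewrite E' -natr1 mulrDl mul1r lerD2r.
have a0 : adj origin left0 by [].
have a1 : adj (vshift (3 * k)%N%:Z left0) (vshift (3 * k)%N%:Z origin) by rewrite adj_vshift.
have r0 := reach_up left0 (3 * k).
apply: le_trans (tri _ _ _ _ _ (reach_trans (reach_adj a0) r0) (reach_adj a1)) _.
apply: le_trans (lerD (tri _ _ _ _ _ (reach_adj a0) r0) (step _ _ a1)) _.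
have := step _ _ a0; have := column k.
have : k%:R * mean left0 (vshift 3%:Z left0) <=
    k%:R * (3 * A%:R + 3 - 256^-1 ^+ 3 * (A%:R - 2)).
  by rewrite ler_wpM2l//; exact: mean_dist_left_block.
by rewrite -!/(mean _ _); lra.
Qed.

End strict_inequality.

Lemma time_constant_inhom_lt (R : realType) (A : nat) (l : R) :
  (1 < A)%N -> 3 * 256 ^+ 3 + 2 < A%:R :> R ->
  (fun n => mean_dist (255 / 256 : R) (weight_inhom A) (0%:Z, 0%:Z)
     (vshift n%:Z (0%:Z, 0%:Z)) / n%:R) @ \oo --> l -> l < A%:R.
Proof.
move=> A1 Abig ml; set x : R := 256^-1 ^+ 3 * (A%:R - 2).
have x3 : 3 < x.
  by rewrite /x exprVn mulrC ltr_pdivlMr ?exprn_gt0// ltrBrDr.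
(* Per block the net gain is [x - 3], that is [(x - 3) / 3] per unit of height; half of it is given
   up to absorb the two horizontal edges. *)
have : l <= A%:R - (x - 3) / 6.
  apply: (cvg_le_frequently ml) => N.
  (* This makes the boundary cost [2 * (2 * A)] at most [k * (x - 3) / 2]. *)
  pose k := (N + Num.trunc (4 * (2 * A)%:R / (x - 3))).+1.
  have kx : 4 * (2 * A)%:R / (x - 3) <= k%:R.
    by apply: le_trans (ltW (truncnS_gt _)) _; rewrite ler_nat /k ltnS leq_addl.
  exists (3 * k)%N; first by rewrite /k; lia.
  rewrite ler_pdivrMr ?ltr0n//; apply: le_trans (mean_dist_inhom_le R A1 k) _.
  rewrite -/x natrM; move: kx; rewrite ler_pdivrMr; last by lra.
  by lra.
by move/le_lt_trans; apply; lra.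
Qed.

Lemma time_constant_neg_ge (R : realType) (A : nat) (l : R) : (1 < A)%N ->
  (fun n => mean_dist (255 / 256 : R) (fun=> weight_neg A) (0%:Z, 0%:Z)
     (vshift n%:Z (0%:Z, 0%:Z)) / n%:R) @ \oo --> l -> A%:R <= l.
Proof.
move=> A1 ml; apply: (ler_cvg_to (cvg_cst (A%:R : R)) ml).
near=> n; have n0 : (0 < n)%N by near: n; exact: nbhs_infty_gt.
by rewrite ler_pdivlMr ?ltr0n//; exact: mean_dist_neg_ge.
Unshelve. all: by end_near.
Qed.

Lemma time_constant_pos_ge (R : realType) (A : nat) (l : R) : (1 < A)%N ->
  (fun n => mean_dist (255 / 256 : R) (fun=> weight_pos A) (0%:Z, 0%:Z)
     (vshift n%:Z (0%:Z, 0%:Z)) / n%:R) @ \oo --> l -> A%:R <= l.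
Proof.
move=> A1 ml.
have lim : (fun n => A%:R * (1 - 2^-1 ^+ n) : R) @ \oo --> (A%:R : R).
  rewrite -[X in _ --> X]mulr1; apply: cvgMr; rewrite -[X in _ --> X]subr0.
  by apply: cvgB; [exact: cvg_cst|apply: cvg_expr; rewrite ger0_norm; lra].
apply: (ler_cvg_to lim ml).
near=> n; have n0 : (0 < n)%N by near: n; exact: nbhs_infty_gt.
rewrite ler_pdivlMr ?ltr0n// mulrAC; exact: mean_dist_pos_ge.
Unshelve. all: by end_near.
Qed.

Lemma ne2E : ne2 = fun n => vshift n%:Z (0%:Z, 0%:Z).
Proof. by apply/funext => n; rewrite /ne2 /vshift add0r. Qed.

Theorem theorem5 (R : realType) :
  exists (Fm Fp : probability R R) (mubar mum mup : R),
    [/\ not_point_mass Fm /\ not_point_mass Fp,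
        bounded_nonneg_law Fm /\ bounded_nonneg_law Fp,
        (* mubar(e2) is the a.s. limit of T(0, n e2)/n in the inhomogeneous model *)
        (forall (d : measure_display) (Omega : measurableType d)
                (P : probability Omega R) (tau : edge -> Omega -> R),
            indep_edge_weights P tau (fun e => if edge_neg e then Fm else Fp) ->
            {ae P, forall w, (fun n : nat =>
               passage_time tau (0%:Z, 0%:Z) (ne2 n) w / n%:R) @ \oo --> mubar}),
        (* mu_-(e2): limit in probability of T(0, n e2)/n for i.i.d. F_- weights *)
        (forall (d : measure_display) (Omega : measurableType d)
                (P : probability Omega R) (tau : edge -> Omega -> R),
            indep_edge_weights P tau (fun _ => Fm) ->
            forall eps : R, 0 < eps ->
            (fun n : nat => P [set w | eps <=
               `|passage_time tau (0%:Z, 0%:Z) (ne2 n) w / n%:R - mum|])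
              @ \oo --> 0%E) /\
        (* mu_+(e2): same with i.i.d. F_+ weights *)
        (forall (d : measure_display) (Omega : measurableType d)
                (P : probability Omega R) (tau : edge -> Omega -> R),
            indep_edge_weights P tau (fun _ => Fp) ->
            forall eps : R, 0 < eps ->
            (fun n : nat => P [set w | eps <=
               `|passage_time tau (0%:Z, 0%:Z) (ne2 n) w / n%:R - mup|])
              @ \oo --> 0%E) &
        mubar < Num.min mum mup].
Proof.
pose q : R := 255 / 256.
have q01 : 0 <= q <= 1 by rewrite /q; apply/andP; split; lra.
have q01s : 0 < q < 1 by rewrite /q; apply/andP; split; lra.
(* The threshold says exactly that the mean gain [256^-1 ^+ 3 * (A - 2)] exceeds the loss 3. *)
have [A A1 Abig] : exists2 A : nat, (1 < A)%N & 3 * 256 ^+ 3 + 2 < A%:R :> R.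
  exists (Num.trunc (3 * 256 ^+ 3 + 2 : R)).+2 => //.
  by apply: lt_trans (truncnS_gt _) _; rewrite ltr_nat.
pose wm := weight_neg A; pose wp := weight_pos A.
pose law (w : bool -> nat) := two_point_law q (w true)%:R (w false)%:R.
have neq (w : bool -> nat) : w true != w false -> (w true)%:R != (w false)%:R :> R.
  by rewrite eqr_nat.
have wm_neq : wm true != wm false by rewrite /wm /=; lia.
have wp_neq : wp true != wp false by rewrite /wp /=; lia.
have law_hi w : w true != w false -> law w [set (w true)%:R] = q%:E.
  by move=> /neq; exact: two_point_law_hi.
have law_supp w : law w [set x | x = (w true)%:R \/ x = (w false)%:R] = 1%E.
  by apply: two_point_law_full => //; [left|right].
(* The three constants come from finite averages, before any probability space is given, so they
   serve all realizations of the weights. *)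
have [lm hlm] := mean_dist_cvg q01 (fun=> weight_neg_gt0 A1) (fun=> weight_neg_le A1)
  (fun _ _ _ => erefl) (0%:Z, 0%:Z).
have [lp hlp] := mean_dist_cvg q01 (fun=> weight_pos_gt0 A1) (fun=> weight_pos_le A1)
  (fun _ _ _ => erefl) (0%:Z, 0%:Z).
have [li hli] := mean_dist_cvg q01 (weight_inhom_gt0 A1) (weight_inhom_le A1)
  (weight_inhom_shift A) (0%:Z, 0%:Z).
exists (law wm), (law wp), li, lm, lp; split.
- by split; apply: two_point_law_not_point_mass => //; exact: neq.
- by split; apply: two_point_law_bounded.
- move=> d Omega P tau indep; rewrite ne2E.
  have mono e : (weight_inhom A e false <= weight_inhom A e true)%N.
    by rewrite /weight_inhom /weight_neg /weight_pos; case: ifP => _; lia.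
  pose L e := if edge_neg e then law wm else law wp.
  have hi e : L e [set (weight_inhom A e true)%:R] = q%:E.
    by rewrite /L /weight_inhom; case: ifP => _; exact: law_hi.
  have supp e : L e [set x | x = (weight_inhom A e true)%:R \/ x = (weight_inhom A e false)%:R] = 1%E.
    by rewrite /L /weight_inhom; case: ifP => _; exact: law_supp.
  exact: (passage_time_cvg_ae q01 (weight_inhom_gt0 A1) (weight_inhom_le A1) mono
    indep hi supp hli).
- split=> d Omega P tau indep eps eps0; rewrite ne2E.
  + apply: (passage_time_cvg_in_probability q01 (fun=> weight_neg_gt0 A1)
      (fun=> weight_neg_le A1) _ indep _ _ hlm eps0) => e; [by rewrite /weight_neg|exact: law_hi|exact: law_supp].
  + apply: (passage_time_cvg_in_probability q01 (fun=> weight_pos_gt0 A1)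
      (fun=> weight_pos_le A1) _ indep _ _ hlp eps0) => e; [by rewrite /weight_pos; lia|exact: law_hi|exact: law_supp].
- have lt_li := time_constant_inhom_lt A1 Abig hli.
  by rewrite lt_min (lt_le_trans lt_li (time_constant_neg_ge A1 hlm))
    (lt_le_trans lt_li (time_constant_pos_ge A1 hlp)).
Qed.
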